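(* For every $\varepsilon>0$ and every integer $\Delta\ge 2$ there exists a constant $c=c(\varepsilon,\Delta)$ such that the following holds. Let $F$ be an $n$-vertex graph with maximum degree $\Delta(F)\le \Delta$. If $p\ge c\,n^{-2/(\Delta+1)}$ and $G$ is an $n$-vertex graph with at least $\varepsilon n^2$ edges, then with high probability $G\cup G(n,p)$ contains a copy of $F$.
   Context: $G(n,p)$ is the binomial random graph on the same vertex set as $G$, in which each pair of vertices is an edge independently with probability $p$; $G\cup G(n,p)$ is the graph on this vertex set whose edge set is the union of the two edge sets. ''With high probability'' means with probability tending to $1$ as $n\to\infty$. *)

(* Defs.v *)
From HB Require Import structures.
From mathcomp Require Import all_boot all_order all_algebra.

Set Implicit Arguments.
Unset Strict Implicit.
Unset Printing Implicit Defensive.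

Import GRing.Theory.
Local Open Scope ring_scope.

Definition pairs (V : finType) : {set {set V}} := [set e : {set V} | #|e| == 2%N].

(* Finite simple graphs with vertex set V, given by their edge sets. *)
Record sgraph (V : finType) := SGraph {
  edges : {set {set V}};
  edges_pairs : edges \subset pairs V
}.

HB.instance Definition _ (V : finType) := [isSub for @edges V].
HB.instance Definition _ (V : finType) := [Finite of sgraph V by <:].

Lemma gunion_subproof (V : finType) (G H : sgraph V) :
  edges G :|: edges H \subset pairs V.
Proof. by rewrite subUset !edges_pairs. Qed.

Definition gunion (V : finType) (G H : sgraph V) : sgraph V :=
  SGraph (gunion_subproof G H).

Definition degree (V : finType) (G : sgraph V) (v : V) : nat :=
  #|[set e in edges G | v \in e]|.

Definition max_degree (V : finType) (G : sgraph V) : nat :=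
  \max_(v : V) degree G v.

(* A copy of F in H is a not necessarily induced subgraph of H isomorphic
   to F, i.e. the image of an injective homomorphism from F to H. *)
Definition contains_copy (V W : finType) (F : sgraph V) (H : sgraph W) : bool :=
  [exists f : {ffun V -> W},
    injectiveb f && [forall e in edges F, (f @: e) \in edges H]].

(* The probability that the binomial random graph G(V, p) is equal to H. *)
Definition gnp_pmf (R : comPzRingType) (V : finType) (p : R) (H : sgraph V) : R :=
  \prod_(e in pairs V) (if e \in edges H then p else 1 - p).

Definition gnp_pr (R : comPzRingType) (V : finType) (p : R)
    (A : pred (sgraph V)) : R :=
  \sum_(H : sgraph V | A H) gnp_pmf p H.

Lemma sum_sgraph_prod (R : comPzRingType) (V : finType) (f g : {set V} -> R) :
  \sum_(H : sgraph V) \prod_(e in pairs V) (if e \in edges H then f e else g e)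
  = \prod_(e in pairs V) (f e + g e).
Proof.
pose f' e := if e \in pairs V then f e else 0.
pose g' e := if e \in pairs V then g e else 1.
transitivity (\prod_e (f' e + g' e)); last first.
  rewrite [RHS]big_mkcond; apply: eq_bigr => e _.
  by rewrite /f' /g'; case: ifP => // _; rewrite add0r.
rewrite bigA_distr (bigID (fun J : {set {set V}} => J \subset pairs V)) /=.
rewrite [X in _ + X]big1 ?addr0; last first.
  move=> J /subsetPn[e eJ eP]; rewrite (bigD1 e) //= eJ /f' (negbTE eP).
  by rewrite mul0r.
rewrite (reindex_omap (fun H : sgraph V => edges H) insub) /=; last first.
  by move=> J JP; rewrite insubT.
apply: eq_big => [H|H _].
  by rewrite edges_pairs valK eqxx.
rewrite big_mkcond; apply: eq_bigr => e _; rewrite /f' /g'.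
case: ifP => // /negbT eP; case: ifP => // eH.
by rewrite (subsetP (edges_pairs H) _ eH) in eP.
Qed.

(* gnp_pr p is the product distribution: it has total mass 1, and the edges of
   the random graph are independent, each being present with probability p. *)
Lemma gnp_pr_edges (R : comPzRingType) (V : finType) (p : R) (A B : {set {set V}}) :
  A \subset pairs V -> B \subset pairs V -> [disjoint A & B] ->
  gnp_pr p [pred H | (A \subset edges H) && [disjoint B & edges H]]
  = p ^+ #|A| * (1 - p) ^+ #|B|.
Proof.
move=> AP BP dAB.
pose f e := if e \in B then 0 else p.
pose g e := if e \in A then 0 else 1 - p.
transitivity (\prod_(e in pairs V) (f e + g e)).
  rewrite -sum_sgraph_prod /gnp_pr big_mkcond; apply: eq_bigr => H _ /=.
  case: ifP => [/andP[AH BH]|/negbT].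
    apply: eq_bigr => e _; rewrite /f /g; case: ifP => eH.
      by rewrite (disjointFl BH eH).
    by case: ifP => // /(subsetP AH); rewrite eH.
  rewrite negb_and => /orP[/subsetPn[e eA eH]|].
    by rewrite (bigD1 e) ?(subsetP AP) //= (negbTE eH) /g eA mul0r.
  rewrite -setI_eq0 => /set0Pn[e /setIP[eB eH]].
  by rewrite (bigD1 e) ?(subsetP BP) //= eH /f eB mul0r.
rewrite -!prodr_const [X in X * _]big_mkcond [X in _ * X]big_mkcond.
rewrite -big_split [LHS]big_mkcond /=; apply: eq_bigr => e _; rewrite /f /g.
case: (boolP (e \in A)) => eA.
  by rewrite (subsetP AP) // (disjointFr dAB eA) addr0 mulr1.
case: (boolP (e \in B)) => eB; first by rewrite (subsetP BP) // add0r mul1r.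
by case: ifP => _; rewrite ?mulr1 // addrC subrK.
Qed.

(* Main.v *)
(* Let r = Delta + 1. Among connected graphs of maximum degree at most Delta,
   only K_r has (edges) / (vertices - 1) as large as r / 2, and every other one
   stays below r / 2 by a fixed amount. So the part of F outside its K_r
   components is polynomially more spread than n^(-2/r), and a bounded number
   of Park-Pham fragment rounds embeds it without logarithmic loss.
   In G one finds, by density increment, two disjoint linear sets R1, R2 such
   that all their large sub-pairs have positive density. One fragment round at
   density C n^(-2/r) tiles almost all of the complement of R1 and R2 by copies
   of K_r; these receive all but at most t = O(n) of the K_r components of F.
   Each remaining K_r component gives up one edge, which a random choice of t
   disjoint edges of G between R1 and R2 supplies; the graph still to be embedded
   now contains no K_r, so it is again polynomially spread. *)
Require Import Defs.
From mathcomp Require Import all_boot all_order all_algebra all_fingroup.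
From mathcomp Require Import ring lra zify.
Set Implicit Arguments.
Unset Strict Implicit.
Unset Printing Implicit Defensive.
Import Order.TTheory GRing.Theory Num.Theory.
Local Open Scope ring_scope.

(** * Random subsets *)

(** A fragment round shrinks what is missing by a factor [mu], where [mu ^+ 2] bounds the ratio of
    the spread to the density. While copies of K_r are present this ratio is a constant, so
    boundedly many rounds cannot finish the embedding; but one round leaves only a small proportion
    of edges missing, and a missing edge spoils at most one clique. Without K_r the ratio is a
    negative power of n. All exponents are kept integral by working with y = n^(-1/M), where M =
    r(r^2-1). Then n^(-2/r) is y^(2(r^2-1)), whereas a K_r-free graph has spread of order y^(2r^2).
    The surplus y^2 makes [mu] a constant multiple of y, and n y^M = 1 shows that M+1 rounds bring
    O(n) missing edges below one. Every failure probability is O(y). Pinning linearly many edges on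
    G must not destroy the spread: each prescribed endpoint has to cost a factor O(1/n). This is why
    the pair R1, R2 must stay dense after the loss of most of its vertices. *)

Section RandomSubset.
Variables (R : realFieldType) (X : finType).
Implicit Types (E W A : {set X}) (p q : R) (f g : {set X} -> R).

Lemma sum_subset_expr E (a b : R) :
  \sum_(W : {set X} | W \subset E) a ^+ #|W| * b ^+ #|E :\: W| = (a + b) ^+ #|E|.
Proof.
pose F x := if x \in E then a else 0; pose G x := if x \in E then b else 1.
transitivity (\prod_x (F x + G x)); last first.
  rewrite -prodr_const [RHS]big_mkcond; apply: eq_bigr => x _.
  by rewrite /F /G; case: ifP => // _; rewrite add0r.
rewrite bigA_distr big_mkcond; apply: eq_bigr => W _.
case: ifP => [WE|/negbT/subsetPn[x xW xE]]; last first.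
  by rewrite (bigD1 x) //= xW /F (negbTE xE) mul0r.
rewrite -!prodr_const [X in X * _]big_mkcond [X in _ * X]big_mkcond -big_split /=.
apply: eq_bigr => x _; rewrite /F /G !inE.
case: (boolP (x \in W)) => [xW|xW] /=; first by rewrite (subsetP WE) // mulr1.
by rewrite mul1r.
Qed.

(** Expectation over the [p]-random subset of [E], as a finite sum polynomial in [p]: identities
    hold for every [p], and only inequalities ask for [0 <= p <= 1]. *)
Definition Ex E p f : R :=
  \sum_(W : {set X} | W \subset E) p ^+ #|W| * (1 - p) ^+ #|E :\: W| * f W.

Lemma Ex_cst E p c : Ex E p (fun=> c) = c.
Proof.
by rewrite /Ex -big_distrl /= sum_subset_expr addrC subrK expr1n mul1r.
Qed.

Lemma ExD E p f g : Ex E p (fun W => f W + g W) = Ex E p f + Ex E p g.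
Proof. by rewrite -big_split /=; apply: eq_bigr => W _; rewrite mulrDr. Qed.

Lemma ExZ E p c f : Ex E p (fun W => c * f W) = c * Ex E p f.
Proof. by rewrite mulr_sumr; apply: eq_bigr => W _; rewrite mulrCA. Qed.

Lemma Ex_sum E p (I : Type) (s : seq I) (P : pred I) (f : I -> {set X} -> R) :
  Ex E p (fun W => \sum_(i <- s | P i) f i W) = \sum_(i <- s | P i) Ex E p (f i).
Proof.
by rewrite exchange_big; apply: eq_bigr => W _; rewrite mulr_sumr.
Qed.

Lemma wt_ge0 p (a b : nat) : 0 <= p <= 1 -> 0 <= p ^+ a * (1 - p) ^+ b.
Proof. by case/andP=> p0 p1; rewrite mulr_ge0 ?exprn_ge0 ?subr_ge0. Qed.

Lemma le_Ex E p f g : 0 <= p <= 1 ->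
  (forall W, W \subset E -> f W <= g W) -> Ex E p f <= Ex E p g.
Proof.
by move=> p01 fg; apply: ler_sum => W WE; rewrite ler_wpM2l ?wt_ge0 ?fg.
Qed.

(* Given the union W, the first set W1 is a subset of W and the second one
   consists of W :\: W1 and of an arbitrary subset of W1. *)
Lemma Ex_union E p q f :
  Ex E p (fun W1 => Ex E q (fun W2 => f (W1 :|: W2))) = Ex E (p + q - p * q) f.
Proof.
pose w W1 W2 : R := p ^+ #|W1| * (1 - p) ^+ #|E :\: W1|
  * (q ^+ #|W2| * (1 - q) ^+ #|E :\: W2|).
transitivity (\sum_(W : {set X} | W \subset E)
  \sum_(W1 : {set X} | W1 \subset W) \sum_(W2 : {set X} | (W2 \subset E) && (W1 :|: W2 == W))
     w W1 W2 * f W).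
  transitivity (\sum_(W1 : {set X} | W1 \subset E) \sum_(W2 : {set X} | W2 \subset E)
     w W1 W2 * f (W1 :|: W2)).
    apply: eq_bigr => W1 _; rewrite mulr_sumr; apply: eq_bigr => W2 _.
    by rewrite /w !mulrA.
  under eq_bigr => W1 W1E.
    rewrite (partition_big (fun W2 => W1 :|: W2) (fun W => W \subset E)) /=; last first.
      by move=> W2 W2E; rewrite subUset W1E.
    over.
  rewrite (exchange_big_dep (fun W : {set X} => W \subset E)) //=.
  apply: eq_bigr => W WE; rewrite [RHS]big_mkcond /= [LHS]big_mkcond /=.
  apply: eq_bigr => W1 _; case: ifP => W1E; case: ifP => W1W //.
  - by apply: eq_bigr => W2 /andP[_ /eqP->].
  - rewrite big1 // => W2 /andP[_ /eqP WW]; move: W1W.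
    by rewrite -WW subsetUl.
  - by rewrite WE (subset_trans W1W WE) in W1E.
apply: eq_bigr => W WE; under eq_bigr do rewrite -mulr_suml.
rewrite -mulr_suml; congr (_ * _).
transitivity (\sum_(W1 : {set X} | W1 \subset W)
   (((1 - p) * (1 - q)) ^+ #|E :\: W|) * (p ^+ #|W1| * ((1 - p) * q) ^+ #|W :\: W1|)).
  apply: eq_bigr => W1 W1W.
  rewrite (reindex_onto (fun Z => Z :|: (W :\: W1)) (fun W2 => W2 :&: W1)) /=; last first.
    move=> W2 /andP[W2E /eqP WW]; apply/setP=> x.
    move/setP/(_ x): WW; move/subsetP/(_ x): W1W; rewrite !inE.
    by case: (x \in W1); case: (x \in W2); case: (x \in W) => //= /(_ isT).
  rewrite (eq_bigl (fun Z : {set X} => Z \subset W1)); last first.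
    move=> Z; apply/idP/idP => [/andP[_ /eqP <-]|ZW1]; first by rewrite subsetIr.
    have ZW := subset_trans ZW1 W1W.
    rewrite subUset (subset_trans ZW WE) (subset_trans (subsetDl _ _) WE) /=.
    apply/andP; split; apply/eqP/setP=> x; rewrite !inE;
      move/subsetP/(_ x): W1W; move/subsetP/(_ x): ZW1;
      by case: (x \in W1); case: (x \in Z); case: (x \in W) => //= H1 H2;
        try (by have := H1 isT); try (by have := H2 isT).
  transitivity (\sum_(Z : {set X} | Z \subset W1)
     p ^+ #|W1| * (1 - p) ^+ #|E :\: W1| * (q ^+ #|W :\: W1| * (1 - q) ^+ #|E :\: W|)
       * (q ^+ #|Z| * (1 - q) ^+ #|W1 :\: Z|)).
    apply: eq_bigr => Z ZW1; rewrite /w.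
    have -> : #|Z :|: W :\: W1| = (#|Z| + #|W :\: W1|)%N.
      rewrite cardsU disjoint_setI0 ?cards0 ?subn0 //.
      rewrite disjoint_sym disjoints_subset; apply/subsetP => x; rewrite !inE.
      by case/andP=> xW1 _; apply: contra xW1; apply/subsetP.
    have -> : #|E :\: (Z :|: W :\: W1)| = (#|E :\: W| + #|W1 :\: Z|)%N.
      rewrite -cardsUI [X in (_ + X)%N](_ : _ = 0%N) ?addn0; last first.
        apply/eqP; rewrite cards_eq0; apply/eqP/setP=> x; rewrite !inE.
        move/subsetP/(_ x): W1W; case: (x \in W1); rewrite ?andbF //=.
        by move=> ->//; rewrite andbF.
      congr #|pred_of_set _|; apply/setP=> x; rewrite !inE.
      move/subsetP/(_ x): W1W; move/subsetP/(_ x): ZW1; move/subsetP/(_ x): WE.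
      by case: (x \in W1); case: (x \in Z); case: (x \in W); case: (x \in E)
        => //= H1 H2 H3; try (by have := H1 isT); try (by have := H2 isT); try (by have := H3 isT).
    by rewrite !exprD; ring.
  rewrite -mulr_sumr sum_subset_expr subrKC expr1n mulr1.
  have -> : #|E :\: W1| = (#|E :\: W| + #|W :\: W1|)%N.
    rewrite -cardsUI [X in (_ + X)%N](_ : _ = 0%N) ?addn0; last first.
      apply/eqP; rewrite cards_eq0; apply/eqP/setP=> x; rewrite !inE.
      by case: (x \in W); rewrite ?andbF.
    congr #|pred_of_set _|; apply/setP=> x; rewrite !inE.
    move/subsetP/(_ x): W1W; move/subsetP/(_ x): WE.
    by case: (x \in W1); case: (x \in W); case: (x \in E)
        => //= H1 H2; try (by have := H1 isT); try (by have := H2 isT).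
  by rewrite exprD !exprMn; ring.
rewrite -mulr_sumr sum_subset_expr mulrC; congr (_ ^+ _ * _ ^+ _); ring.
Qed.

(** Coupling: the [q]-random set is the union of the [p]-random one and an independent set of
    density [(q - p) / (1 - p)]; the case [p = 1] is treated apart. *)
Lemma Ex_mono E p q f : 0 <= p -> p <= q -> q <= 1 ->
  (forall W W', W \subset W' -> f W <= f W') -> Ex E p f <= Ex E q f.
Proof.
move=> p0 pq q1 fm.
have [p1|p1] := eqVneq p 1; first by have -> : q = p by apply/eqP; rewrite eq_le pq p1 q1.
have p1' : p < 1 by rewrite lt_neqAle p1 (le_trans pq q1).
have pos : 0 < 1 - p by rewrite subr_gt0.
have -> : q = p + (q - p) / (1 - p) - p * ((q - p) / (1 - p)).
  by field; rewrite gt_eqF.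
rewrite -Ex_union; apply: le_Ex => [|W _]; first by rewrite p0 ltW.
rewrite -[leLHS](Ex_cst E ((q - p) / (1 - p))); apply: le_Ex => [|W' _].
  by rewrite divr_ge0 ?subr_ge0 ?(ltW p1') // ler_pdivrMr // mul1r lerB.
exact/fm/subsetUl.
Qed.

Lemma markov_Ex E p f (a : R) : 0 <= p <= 1 -> (forall W, W \subset E -> 0 <= f W) ->
  a * Ex E p (fun W => (a <= f W)%R%:R) <= Ex E p f.
Proof.
move=> p01 f0; rewrite -ExZ; apply: le_Ex => // W WE.
by case: (boolP (a <= f W)) => [|_]; rewrite ?mulr1 ?mulr0 //; exact: f0.
Qed.

End RandomSubset.

(** * Fragments *)

(** A substitute for Stirling: [d ^ d] is at most the falling factorial [d.*2 ^_ d], which is the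
    factorial of [d] times a central binomial coefficient. It serves to bound ['C(L, j) * j ^ j] by
    [(4 * L) ^ j]. *)
Lemma leq_expn_fact (d : nat) : (d ^ d <= 4 ^ d * d`!)%N.
Proof.
have ffE : (d.*2 ^_ d = 'C(d.*2, d) * d`!)%N by rewrite bin_ffact.
have le4 : ('C(d.*2, d) <= 4 ^ d)%N.
  have -> : (4 ^ d = \sum_(i < d.*2.+1) 'C(d.*2, i))%N.
    rewrite (_ : 4 = (1 + 1) ^ 2)%N // -expnM mul2n expnDn.
    by apply: eq_bigr => i _; rewrite !exp1n !muln1.
  have ltd : (d < d.*2.+1)%N by rewrite ltnS -addnn leq_addr.
  by rewrite (bigD1 (Ordinal ltd)) //= leq_addr.
apply: leq_trans (_ : d.*2 ^_ d <= _)%N; last by rewrite ffE leq_mul2r le4 orbT.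
rewrite ffact_prod -[X in (_ ^ X)%N]card_ord -prod_nat_const.
by apply: leq_prod => i _; have := ltn_ord i; lia.
Qed.

Lemma leq_exp_base (m n e : nat) : (m <= n -> m ^ e <= n ^ e)%N.
Proof. by case: e => // e mn; rewrite leq_exp2r. Qed.

Lemma sqr_gt1 (n : nat) : (1 < n -> 1 < n ^ 2)%N.
Proof. by move=> n1; rewrite -mulnn (leq_trans n1) // leq_pmulr // ltnW. Qed.

(** In terms of probability: a random permutation of [w] points takes [d] prescribed values with
    probability at most [(16 / w) ^ d]. If [w] is at least [2 * d], each factor of the falling
    factorial is at least [w / 2]; otherwise [w ^ d] is below [(2 * d) ^ d] and the factorial bound
    applies. *)
Lemma expn_ffact (w d : nat) : (d <= w -> w ^ d <= 16 ^ d * w ^_ d)%N.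
Proof.
move=> dw; case: (leqP d.*2 w) => d2.
  apply: leq_trans (_ : (2 ^ d * w ^_ d <= _))%N; last first.
    by rewrite leq_mul2r leq_exp_base ?orbT.
  rewrite ffact_prod -[X in (w ^ X)%N]card_ord -prod_nat_const.
  rewrite -[X in (2 ^ X)%N]card_ord -prod_nat_const -big_split /=.
  by apply: leq_prod => i _; have := ltn_ord i; lia.
apply: leq_trans (_ : (2 * d) ^ d <= _)%N; first by apply: leq_exp_base; lia.
rewrite expnMn; apply: leq_trans (_ : 2 ^ d * (4 ^ d * d`!) <= _)%N.
  by rewrite leq_mul2l leq_expn_fact orbT.
rewrite mulnA -expnMn leq_mul ?leq_exp_base //.
by rewrite -bin_ffact leq_pmull // bin_gt0.
Qed.

Lemma card_set_sum (I : finType) (J : {set I}) (P : pred I) :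
  #|[set i in J | P i]| = (\sum_(i in J) P i)%N.
Proof.
rewrite -sum1_card big_mkcond [RHS]big_mkcond; apply: eq_bigr => i _.
by rewrite inE; case: (i \in J); case: (P i).
Qed.

Section Fragments.
Variables (R : realFieldType) (X I : finType).
Implicit Types (E W T : {set X}) (S : I -> {set X}) (J : {set I}).

(** The Park-Pham minimum fragment: among the members covered by [W] and [S i] together, the
    smallest part still missing from [W]. The family is indexed, so fragments count with
    multiplicity and, as subsets of the [S i], inherit the spread. *)
Definition fragment S J W (i : I) : {set X} :=
  S [arg min_(k < i | (k \in J) && (S k \subset W :|: S i)) #|S k :\: W|] :\: W.

Lemma fragmentP S J W i : i \in J ->
  exists k, [/\ k \in J, S k \subset W :|: S i, fragment S J W i = S k :\: W
    & forall k', k' \in J -> S k' \subset W :|: S i ->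
        (#|S k :\: W| <= #|S k' :\: W|)%N].
Proof.
move=> iJ; rewrite /fragment; case: arg_minnP => [|k /andP[kJ kS] kmin].
  by rewrite iJ subsetUr.
by exists k; split => // k' k'J k'S; apply: kmin; rewrite k'J.
Qed.

Lemma fragment_sub S J W i : i \in J -> fragment S J W i \subset S i.
Proof.
by case/(@fragmentP S J W) => k [_ kS -> _]; rewrite subDset.
Qed.

Lemma fragmentC S J W i : [disjoint W & fragment S J W i].
Proof. by rewrite disjoints_subset /fragment setCD subsetUr. Qed.

(* Park-Pham encoding: W is recovered from Z = W :|: T and the fragment T, and
   by minimality T is contained in any member of the family included in Z. *)
Lemma Ex_fragment_card E S J (p q L N : R) (j : nat) :
  0 < p <= 1 -> 0 <= N -> 0 <= q -> 0 <= L ->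
  (forall i, i \in J -> S i \subset E) ->
  (forall i, i \in J -> #|S i|%:R <= L) ->
  (forall T, #|[set i in J | T \subset S i]|%:R <= q ^+ #|T| * N) ->
  Ex E p (fun W => #|[set i in J | #|fragment S J W i| == j]|%:R)
    * (p ^+ j * j%:R ^+ j) <= (4 * L * q) ^+ j * N.
Proof.
move=> /andP[p0 p1] N0 q0 L0 SE SL spread.
(* [star Z] depends on [Z] alone, so given [Z] there are at most ['C(#|star Z|, j)] candidates for
   [T]. The default is not reached when [Z] comes from a fragment. *)
pose star (Z : {set X}) := if [pick k in J | S k \subset Z] is Some k then S k else set0.
have starP (Z : {set X}) : star Z \subset Z /\ (#|star Z|%:R <= L).
  by rewrite /star; case: pickP => [k /andP[kJ kZ]|_]; rewrite ?cards0 ?sub0set; auto.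
pose P (W T : {set X}) := [&& T \subset E, #|T| == j, [disjoint W & T] & T \subset star (W :|: T)].
have le1 (W : {set X}) : #|[set i in J | #|fragment S J W i| == j]|%:R
    <= \sum_(T | P W T) q ^+ j * N.
  rewrite -sum1_card (partition_big (fragment S J W) (P W)) /= => [|i]; last first.
    rewrite inE => /andP[iJ /eqP jE]; rewrite /P jE eqxx fragmentC /=.
    have fS := fragment_sub S W iJ; rewrite (subset_trans fS (SE _ iJ)) /=.
    have [k [kJ kS fE kmin]] := fragmentP S W iJ.
    rewrite /star; case: pickP => [k' /andP[k'J k'Z]|/(_ k)]; last first.
      rewrite kJ fE /= => /negP[]; apply/subsetP=> x xS.
      by rewrite !inE xS andbT orbN.
    have k'W : S k' \subset W :|: S i.
      by apply: subset_trans k'Z _; rewrite setUS.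
    have sub : S k' :\: W \subset fragment S J W i by rewrite subDset.
    suff /eqP <- : S k' :\: W == fragment S J W i by rewrite subsetDl.
    by rewrite eqEcard sub fE kmin.
  rewrite natr_sum; apply: ler_sum => T /and4P[_ /eqP jE _ _].
  rewrite sum1_card -jE; apply: le_trans (spread T); rewrite ler_nat.
  apply/subset_leq_card/subsetP => i; rewrite unfold_in /= inE => /andP[/andP[iJ _] /eqP <-].
  by rewrite inE iJ fragment_sub.
pose wt (W : {set X}) := p ^+ #|W| * (1 - p) ^+ #|E :\: W|.
have wt0 W : 0 <= wt W by rewrite wt_ge0 // p1 ltW.
(* Adding the [j] new elements of [T] multiplies the weight by [p ^+ j] and removes factors [1 - p],
   which are at most 1. *)
have wtT W T : P W T -> W \subset E -> wt W * p ^+ j <= wt (W :|: T).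
  case/and4P=> TE /eqP jE dWT _ WE; rewrite /wt.
  have -> : #|W :|: T| = (#|W| + j)%N by rewrite cardsU disjoint_setI0 ?cards0 ?subn0 ?jE.
  rewrite exprD mulrAC; apply: ler_wpM2l; first by rewrite mulr_ge0 ?exprn_ge0 ?ltW.
  apply: ler_wiXn2l; [by rewrite subr_ge0|by rewrite gerBl ltW|].
  by apply: subset_leq_card; apply: setDS; apply: subsetUl.
have key : Ex E p (fun W => \sum_(T | P W T) q ^+ j * N) * p ^+ j
    <= \sum_(Z : {set X} | Z \subset E) wt Z * (q ^+ j * N * 'C(#|star Z|, j)%:R).
  rewrite /Ex mulr_suml.
  apply: le_trans (_ : \sum_(W : {set X} | W \subset E) \sum_(T | P W T) wt (W :|: T) * (q ^+ j * N) <= _).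
    apply: ler_sum => W WE; rewrite mulr_sumr mulr_suml; apply: ler_sum => T PT.
    rewrite mulrAC; apply: ler_wpM2r; first by rewrite mulr_ge0 ?exprn_ge0.
    exact: wtT.
  rewrite (exchange_big_dep predT) //=.
  apply: le_trans (_ : \sum_(T : {set X}) \sum_(Z : {set X} | (Z \subset E) && ((#|T| == j) && (T \subset star Z)))
     wt Z * (q ^+ j * N) <= _).
    apply: ler_sum => T _.
    rewrite [leRHS](bigID (fun Z : {set X} => T \subset Z)) /=.
    rewrite -[leLHS]addr0 lerD ?sumr_ge0 //; last first.
      by move=> Z _; rewrite mulr_ge0 ?wt0 // mulr_ge0 ?exprn_ge0.
    rewrite [leRHS](reindex_onto (fun W => W :|: T) (fun Z => Z :\: T)) /=; last first.
      move=> Z /andP[_ TZ]; apply/setP=> x; rewrite !inE.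
      by case: (boolP (x \in T)) => [/(subsetP TZ) ->|]; rewrite ?orbT ?orbF.
    rewrite le_eqVlt; apply/orP; left; apply/eqP; apply: eq_bigl => W.
    rewrite /P subsetUr andbT subUset -!andbA setDUl setDv setU0.
    rewrite (_ : (W :\: T == W) = [disjoint W & T]); last first.
      exact/eqP/setDidPl.
    do 2!(case: (_ \subset E) => //=); case: (#|T| == j) => //=.
    by rewrite andbC.
  rewrite (exchange_big_dep (fun Z : {set X} => Z \subset E)) /=; last first.
    by move=> ? ? _ /andP[].
  apply: ler_sum => Z ZE; rewrite ZE /= [leRHS]mulrA mulr_natr -cards_draws.
  rewrite -sumr_const le_eqVlt; apply/orP; left; apply/eqP.
  by apply: eq_bigl => T; rewrite !inE andbC.
rewrite mulrA; apply: le_trans (_ : _ * p ^+ j * j%:R ^+ j <= _).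
  apply: ler_wpM2r; first by rewrite exprn_ge0.
  apply: ler_wpM2r; first by rewrite exprn_ge0 ?ltW.
  by apply: le_Ex (fun W _ => le1 W); rewrite p1 ltW.
apply: le_trans (ler_wpM2r _ key) _; first by rewrite exprn_ge0.
rewrite mulr_suml -[leRHS](Ex_cst E p); apply: ler_sum => Z ZE.
rewrite -/(wt Z) -[leLHS]mulrA; apply: (ler_wpM2l (wt0 Z)).
have [_ sL] := starP Z.
apply: le_trans (_ : q ^+ j * N * (4 * L) ^+ j <= _); last by rewrite [in leRHS]exprMn [leLHS]mulrC mulrA.
rewrite -[leLHS]mulrA; apply: ler_wpM2l; first by rewrite mulr_ge0 ?exprn_ge0.
rewrite -natrX -natrM exprMn; apply: le_trans (_ : (4 ^ j * #|star Z| ^ j)%:R <= _).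
  rewrite ler_nat; apply: leq_trans (_ : 4 ^ j * #|star Z| ^_ j <= _)%N.
    by rewrite -bin_ffact mulnCA leq_mul2l leq_expn_fact orbT.
  apply: leq_mul => //; rewrite ffact_prod -[X in (_ ^ X)%N]card_ord -prod_nat_const.
  by apply: leq_prod => i _; rewrite leq_subr.
rewrite natrM !natrX; apply: ler_wpM2l; first by rewrite exprn_ge0.
by rewrite lerXn2r ?nnegrE.
Qed.

Lemma sum_geom_tail (x : R) (a b : nat) : 0 <= x <= 1 / 2 ->
  \sum_(a <= j < b) x ^+ j <= 2 * x ^+ a.
Proof.
move=> /andP[x0 x2].
suff sum_le n c : \sum_(c <= j < c + n) x ^+ j <= 2 * x ^+ c.
  case: (leqP a b) => [/subnKC <-|/ltnW ba] //.
  by rewrite big_geq // mulr_ge0 ?exprn_ge0.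
elim: n c => [|n IH] c; first by rewrite addn0 big_geq // mulr_ge0 ?exprn_ge0.
rewrite big_ltn ?addnS ?ltnS ?leq_addr // -addSn.
apply: le_trans (lerD (lexx _) (IH c.+1)) _; rewrite exprS.
have : x * x ^+ c <= 1 / 2 * x ^+ c by rewrite ler_wpM2r ?exprn_ge0.
lra.
Qed.

(** For [j > L * mu] the encoding bound [(4 * L * q / (p * j)) ^ j] is at most [(4 * mu) ^ j]. Since
    [mu <= 1 / 8], these terms at least halve from one [j] to the next and the first one dominates;
    its exponent is [k.+1] because sizes above [L * mu] exceed [k]. *)
Lemma Ex_large_fragments E S J (p q L N mu : R) (k : nat) :
  0 < p <= 1 -> 0 <= N -> 0 <= L -> 0 <= mu <= 1 / 8 -> 0 <= q ->
  q <= p * mu ^+ 2 -> k%:R <= L * mu ->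
  (forall i, i \in J -> S i \subset E) ->
  (forall i, i \in J -> #|S i|%:R <= L) ->
  (forall T, #|[set i in J | T \subset S i]|%:R <= q ^+ #|T| * N) ->
  Ex E p (fun W => #|[set i in J | L * mu < #|fragment S J W i|%:R]|%:R)
    <= 2 * (4 * mu) ^+ k.+1 * N.
Proof.
move=> p01 N0 L0 /andP[mu0 mu8] q0 qp kL SE SL spread.
have [p0 p1] := andP p01.
pose n := #|X|.+1.
have bnd (j : nat) : L * mu < j%:R ->
    Ex E p (fun W => #|[set i in J | #|fragment S J W i| == j]|%:R)
      <= (4 * mu) ^+ j * N.
  move=> Lj; have j0 : 0 < j%:R :> R by rewrite (le_lt_trans _ Lj) ?mulr_ge0.
  have := Ex_fragment_card j p01 N0 q0 L0 SE SL spread; rewrite -exprMn => le.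
  rewrite -(ler_pM2r (exprn_gt0 j (mulr_gt0 p0 j0))); apply: le_trans le _.
  rewrite [leRHS]mulrAC -exprMn; apply: ler_wpM2r => //.
  apply: lerXn2r; rewrite ?nnegrE ?mulr_ge0 ?(ltW p0) ?(ltW j0) //.
  have h1 : L * q <= L * (p * mu ^+ 2) by rewrite ler_wpM2l.
  have h2 : (p * mu) * (L * mu) <= (p * mu) * j%:R.
    by rewrite ler_wpM2l ?(ltW Lj) // mulr_ge0 // ltW.
  by lra.
apply: le_trans (_ : \sum_(k.+1 <= j < n) (4 * mu) ^+ j * N <= _); last first.
  rewrite -mulr_suml ler_wpM2r // sum_geom_tail //; lra.
apply: le_trans (_ : \sum_(k.+1 <= j < n | L * mu < j%:R)
   Ex E p (fun W => #|[set i in J | #|fragment S J W i| == j]|%:R) <= _).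
  rewrite -Ex_sum; apply: le_Ex => [|W _]; first by rewrite ltW.
  rewrite -natr_sum ler_nat card_set_sum.
  under [X in (_ <= X)%N]eq_bigr do rewrite card_set_sum.
  rewrite exchange_big; apply: leq_sum => i iJ; case: (boolP (_ < _)%R) => //= lt.
  have ltn : (k < #|fragment S J W i| < n)%N.
    by rewrite ltnS max_card andbT -(ltr_nat R) (le_lt_trans kL).
  rewrite big_mkcond (bigD1_seq #|fragment S J W i|) ?iota_uniq ?mem_index_iota //=.
  by rewrite lt eqxx leq_addr.
rewrite big_mkcond; apply: ler_sum => j _; case: ifP => [/bnd //|_].
by rewrite mulr_ge0 // exprn_ge0 // mulr_ge0.
Qed.

(** Markov's inequality: if fewer than [beta * N] of the [2 * beta * N] or more members have a small
    fragment, then at least [beta * N] have a large one. *)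
Lemma exists_small_fragments E S J (p q L N mu beta : R) (k : nat) :
  0 < p <= 1 -> 0 < N -> 0 <= L -> 0 <= mu <= 1 / 8 -> 0 <= q ->
  q <= p * mu ^+ 2 -> k%:R <= L * mu -> 0 < beta ->
  (forall i, i \in J -> S i \subset E) ->
  (forall i, i \in J -> #|S i|%:R <= L) ->
  (forall T, #|[set i in J | T \subset S i]|%:R <= q ^+ #|T| * N) ->
  2 * beta * N <= #|J|%:R ->
  1 - 2 * (4 * mu) ^+ k.+1 / beta
    <= Ex E p (fun W => (beta * N <= #|[set i in J | #|fragment S J W i|%:R <= L * mu]|%:R)%R%:R).
Proof.
move=> p01 N0 L0 mu08 q0 qp kL b0 SE SL spread JN.
have p01' : 0 <= p <= 1 by case/andP: p01 => /ltW -> ->.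
pose f W : R := #|[set i in J | L * mu < #|fragment S J W i|%:R]|%:R.
have := @markov_Ex R X E p f (beta * N) p01' (fun W _ => ler0n _ _).
have le1 := Ex_large_fragments p01 (ltW N0) L0 mu08 q0 qp kL SE SL spread.
move=> /le_trans /(_ le1) {le1}; rewrite mulrAC ler_pM2r // => le1.
have : Ex E p (fun W => (beta * N <= f W)%R%:R) <= 2 * (4 * mu) ^+ k.+1 / beta.
  by rewrite ler_pdivlMr // mulrC.
rewrite lerBlDr -(lerD2l (Ex E p (fun W =>
  (beta * N <= #|[set i in J | #|fragment S J W i|%:R <= L * mu]|%:R)%R%:R))).
apply: le_trans.
rewrite -ExD -[leLHS](Ex_cst E p); apply: le_Ex => // W _.
have cardE : #|J|%:R = #|[set i in J | #|fragment S J W i|%:R <= L * mu]|%:R + f W.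
  rewrite /f -natrD !card_set_sum -big_split -sum1_card; congr (_%:R).
  by apply: eq_bigr => i _; rewrite real_leNgt ?num_real //; case: (_ < _).
case: (lerP (beta * N) (f W)) => [_|lt]; first by rewrite lerDr ler0n.
suff -> : beta * N <= #|[set i in J | #|fragment S J W i|%:R <= L * mu]|%:R by rewrite addr0.
lra.
Qed.
End Fragments.

(** * Rounds of exposure *)

Section Rounds.
Variables (R : realFieldType) (X I : finType).
Implicit Types (E W T : {set X}) (S : I -> {set X}) (J : {set I}).

(* The probability of belonging to the union of a independent p-random sets. *)
Fixpoint rounds (p : R) (a : nat) : R :=
  if a is a'.+1 then p + rounds p a' - p * rounds p a' else 0.

Lemma rounds01 p a : 0 <= p <= 1 -> 0 <= rounds p a <= 1.
Proof.
move=> /andP[p0 p1]; elim: a => [|a /andP[r0 r1]] /=; first by rewrite lexx ler01.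
have : 0 <= (1 - p) * (1 - rounds p a) by rewrite mulr_ge0 ?subr_ge0.
have : 0 <= rounds p a * (1 - p) by rewrite mulr_ge0 ?subr_ge0.
by move=> *; apply/andP; split; lra.
Qed.

Lemma rounds_le p a : 0 <= p <= 1 -> rounds p a <= a%:R * p.
Proof.
move=> p01; elim: a => [|a IH] /=; first by rewrite mul0r.
have /andP[r0 _] := rounds01 a p01; have /andP[p0 _] := p01.
have : 0 <= p * rounds p a by rewrite mulr_ge0.
by rewrite -natr1; lra.
Qed.

(** Each round replaces the family by its small fragments: the size bound shrinks by [mu] and the
    proportion [beta] is halved, while [N], and with it the spread, stays. After [a] rounds the
    sizes are below 1, so some fragment is empty. A round fails with probability at most
    [16 * mu / beta]; as [beta] halves each time, these bounds add up to a factor [2 ^+ a - 1]. *)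
Lemma Ex_rounds_contains E S J (p q L N mu beta : R) (a : nat) :
  0 < p <= 1 -> 0 < N -> 0 <= L -> 0 <= mu <= 1 / 8 -> 0 <= q ->
  q <= p * mu ^+ 2 -> L * mu ^+ a < 1 -> 0 < beta ->
  (forall i, i \in J -> S i \subset E) ->
  (forall i, i \in J -> #|S i|%:R <= L) ->
  (forall T, #|[set i in J | T \subset S i]|%:R <= q ^+ #|T| * N) ->
  beta * N <= #|J|%:R ->
  1 - 16 * mu * (2 ^+ a - 1) / beta
    <= Ex E (rounds p a) (fun W => [exists i in J, S i \subset W]%:R).
Proof.
move=> p01 N0 L0 mu08 q0 qp; have /andP[mu0 mu8] := mu08.
have p01' : 0 <= p <= 1 by case/andP: p01 => /ltW -> ->.
elim: a S J L beta L0 => [|a IH] S J L beta L0 Lmu b0 SE SL spread JN /=.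
  rewrite expr0 subrr mulr0 mul0r subr0 -[leLHS](Ex_cst E 0).
  apply: le_Ex => [|W _]; first by rewrite lexx ler01.
  have : J != set0.
    apply/eqP => J0; move: JN; rewrite J0 cards0 => /le_lt_trans.
    by move=> /(_ _ (mulr_gt0 b0 N0)); rewrite ltxx.
  case/set0Pn => i iJ; suff -> : [exists i in J, S i \subset W] by [].
  apply/existsP; exists i; rewrite iJ /=.
  have := le_lt_trans (SL i iJ) _; rewrite expr0 mulr1 in Lmu.
  move/(_ _ Lmu); rewrite (ltr_nat _ _ 1) ltnS leqn0 cards_eq0 => /eqP ->.
  exact: sub0set.
have b20 : 0 < beta / 2 by rewrite divr_gt0.
have JN2 : 2 * (beta / 2) * N <= #|J|%:R 
  by rewrite (_ : 2 * (beta / 2) = beta) //; field.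
(* With [k = 0] only one power of [4 * mu] is gained, which is enough for a bounded number of
   rounds. *)
have kL : 0%:R <= L * mu by rewrite mulr_ge0.
pose ev (W : {set X}) : R :=
  (beta / 2 * N <= #|[set i in J | #|fragment S J W i|%:R <= L * mu]|%:R)%R%:R.
have evP : 1 - 2 * (4 * mu) ^+ 1 / (beta / 2) <= Ex E p ev.
  exact: exists_small_fragments p01 N0 L0 mu08 q0 qp kL b20 SE SL spread JN2.
rewrite -Ex_union.
set delta := 16 * mu * (2 ^+ a - 1) / (beta / 2).
apply: le_trans (_ : Ex E p (fun W => ev W - delta) <= _).
  rewrite ExD Ex_cst; apply: le_trans (lerB evP (lexx _)).
  rewrite /delta expr1 exprS le_eqVlt; apply/orP; left; apply/eqP.
  by field; rewrite gt_eqF.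
apply: le_Ex => // W WE; rewrite /ev; case: (boolP (beta / 2 * N <= _)) => [small|_]; last first.
  rewrite (_ : false%:R = 0) // sub0r; apply: le_trans (_ : 0 <= _).
    rewrite oppr_le0 !mulr_ge0 ?invr_ge0 ?(ltW b20) ?subr_ge0 //.
    by rewrite exprn_ege1 // ler1n.
  rewrite -[leLHS](Ex_cst E (rounds p a)).
  by apply: le_Ex => [|W' _]; rewrite ?rounds01.
apply: le_trans (IH (fragment S J W) _ (L * mu) (beta / 2) _ _ b20 _ _ _ small) _.
- by rewrite mulr_ge0.
- by rewrite -mulrA -exprS.
- by move=> i; rewrite inE => /andP[iJ _]; apply: subset_trans (SE i iJ); apply: fragment_sub.
- by move=> i; rewrite inE => /andP[].
- move=> T; apply: le_trans (spread T); rewrite ler_nat; apply: subset_leq_card.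
  apply/subsetP => i; rewrite !inE => /andP[/andP[iJ _] Ti]; rewrite iJ.
  by apply: subset_trans Ti _; apply: fragment_sub.
apply: le_Ex => [|W' _]; first exact: rounds01.
rewrite ler_nat; case: (boolP [exists i in _, _]) => // /existsP[i /andP[]].
(* The member that gets covered is the [S k] realising the fragment of [i], not necessarily
   [S i]. *)
rewrite inE => /andP[iJ _] iW'; have [k [kJ kS fE _]] := fragmentP S W iJ.
suff -> : [exists i0 in J, S i0 \subset W :|: W'] by [].
by apply/existsP; exists k; rewrite kJ /= -subDset -fE.
Qed.

End Rounds.

(** * Spread of random embeddings *)

Definition nbrs (V : finType) (F : {set {set V}}) (v : V) : {set V} :=
  [set u | [set v; u] \in F].

Definition img_edges (V W : finType) (f : V -> W) (F : {set {set V}}) : {set {set W}} :=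
  [set f @: (e : {set V}) | e in F].

Definition edges_in (V : finType) (F : {set {set V}}) (D : {set V}) : {set {set V}} :=
  [set e in F | e \subset D].

Section Nbrs.
Variables (V : finType) (F : {set {set V}}).
Hypothesis F2 : F \subset pairs V.

Lemma nbrsP e v : e \in F -> v \in e -> exists2 u, u != v & e = [set v; u].
Proof.
move=> /(subsetP F2); rewrite inE => /cards2P[a [b [ab ->]]].
rewrite !inE => /orP[] /eqP->; first by exists b; rewrite // eq_sym.
by exists a; rewrite // setUC.
Qed.

Lemma nbrs_irr v : v \notin nbrs F v.
Proof.
rewrite inE; apply/negP => /(subsetP F2); rewrite inE.
by rewrite setUid cards1.
Qed.

Lemma card_nbrs v : #|nbrs F v| = #|[set e in F | v \in e]|.
Proof.
rewrite -(card_in_imset (f := fun u => [set v; u]) (D := nbrs F v)).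
  congr #|pred_of_set _|; apply/setP=> e; apply/imsetP/idP => [[u uv ->]|].
    by move: uv; rewrite !inE eqxx => ->.
  rewrite inE => /andP[eF ve]; have [u uv eE] := nbrsP eF ve.
  by exists u; rewrite // inE -eE.
move=> u u' uv u'v /setP/(_ u); rewrite !inE eqxx orbT => /esym/orP[] /eqP //.
by move=> uE; move: uv; rewrite uE (negbTE (nbrs_irr v)).
Qed.

End Nbrs.

Section Homs.
Variables (V W : finType) (F : {set {set V}}) (V' : {set V}) (Delta s M : nat).
Hypotheses (F2 : F \subset pairs V) (FV' : forall e, e \in F -> e \subset V').
Hypothesis deg : forall v, (#|[set e in F | v \in e]| <= Delta)%N.
Hypothesis sparse : forall D : {set V}, (s * #|edges_in F D| <= M * #|D|.-1)%N.
Implicit Types (T : {set {set W}}) (D : {set W}) (H : {set {ffun W -> V}}).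

(** Each [h] is a partial inverse, guessing which vertex is sent to each [w] in [D]. One set [H]
    serves all embeddings whose image contains [T], so its size is the cost of a union bound. *)
Definition hom_cover T D H :=
  (forall h w, h \in H -> w \in D -> h w \in V') /\
  (forall f : V -> W, injective f -> T \subset img_edges f F ->
     exists2 h : {ffun W -> V}, h \in H & {in D, forall w, f (h w) = w}).

Lemma hom_cover1 T x : x \in cover T ->
  exists2 H, hom_cover T [set x] H & (#|H| <= #|V|)%N.
Proof.
move=> /bigcupP[e eT xe]; exists [set [ffun=> v] | v in V']; last first.
  by rewrite (leq_trans (leq_imset_card _ _)) // max_card.
split=> [h w /imsetP[v vV' ->] _|f f_inj /subsetP/(_ e eT)]; first by rewrite ffunE.
case/imsetP=> e' e'F eE; move: xe; rewrite eE => /imsetP[v ve xE].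
exists [ffun=> v]; last by move=> w; rewrite inE ffunE => /eqP ->.
by apply/imsetP; exists v => //; apply: subsetP (FV' e'F) _ ve.
Qed.

(** An edge of [T] is the image of an edge of [F]: once the preimage of [w] is guessed, that of [u]
    is one of at most [Delta] neighbours. *)
Lemma hom_coverU1 T D H w u : hom_cover T D H ->
  w \in D -> u \notin D -> [set w; u] \in T ->
  exists2 H', hom_cover T (u |: D) H' & (#|H'| <= Delta * #|H|)%N.
Proof.
move=> [HV' Hf] wD uD wuT.
pose upd (h : {ffun W -> V}) v := [ffun z => if z == u then v else h z].
exists (\bigcup_(h in H) [set upd h v | v in nbrs F (h w)]); last first.
  apply: leq_trans (_ : \sum_(h in H) Delta <= _)%N; last by rewrite sum_nat_const mulnC.
  apply: leq_trans (_ : \sum_(h in H) #|[set upd h v | v in nbrs F (h w)]| <= _)%N.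
    elim/big_rec2: _ => [|h a b hH IH]; first by rewrite cards0.
    by rewrite (leq_trans (leq_card_setU _ _)) // leq_add2l.
  apply: leq_sum => h hH; apply: leq_trans (leq_imset_card _ _) _.
  by rewrite card_nbrs.
split=> [h z /bigcupP[h' h'H /imsetP[v vN ->]]|f f_inj Tf].
  rewrite ffunE !inE; case: eqP => [_ _|_ /= zD]; last exact: HV'.
  by move: vN; rewrite inE => /FV'/subsetP; apply; rewrite !inE eqxx orbT.
have [h hH hf] := Hf f f_inj Tf.
have /imsetP[e eF eE] := subsetP Tf _ wuT.
have hwe : h w \in e.
  rewrite -(mem_imset e (h w) f_inj) -eE hf //.
  by rewrite !inE eqxx.
have [v vh vE] := nbrsP F2 eF hwe.
have fv : f v = u.
  have : f v \in [set w; u] by rewrite eE imset_f // vE !inE eqxx orbT.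
  rewrite !inE => /orP[/eqP fvw|/eqP //].
  by case/eqP: vh; apply: f_inj; rewrite hf.
exists (upd h v).
  by apply/bigcupP; exists h => //; apply/imsetP; exists v; rewrite // inE -vE.
move=> z; rewrite !inE ffunE; case: eqP => [-> _|_ /= zD]; first exact: fv.
exact: hf.
Qed.

(** The root has at most [#|V|] candidates and each further vertex at most [Delta]; [D] grows along
    edges of [T] until none leaves it. *)
Lemma hom_cover_component T x : x \in cover T ->
  exists D H, [/\ x \in D /\ D \subset cover T, hom_cover T D H,
    (#|H| <= #|V| * Delta ^ #|D|.-1)%N & forall w u, w \in D -> [set w; u] \in T -> u \in D].
Proof.
move=> xT; have [H0 H0P H0c] := hom_cover1 xT.
have : exists D H, [/\ x \in D, D \subset cover T, hom_cover T D H
    & (#|H| <= #|V| * Delta ^ #|D|.-1)%N].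
  by exists [set x], H0; rewrite cards1 expn0 muln1 inE eqxx sub1set.
case=> D [H [xD DT HP Hc]].
have [n] := ubnP #|~: D|; elim: n => // n IH in D H xD DT HP Hc *; rewrite ltnS => Dn.
case: (boolP [exists w in D, exists u, ([set w; u] \in T) && (u \notin D)]).
  case/existsP=> w /andP[wD /existsP[u /andP[wuT uD]]].
  have [H' H'P H'c] := hom_coverU1 HP wD uD wuT.
  apply: (IH (u |: D) H') => //.
  - by rewrite !inE xD orbT.
  - rewrite subUset DT sub1set andbT; apply/bigcupP; exists [set w; u] => //.
    by rewrite !inE eqxx orbT.
  - rewrite cardsU1 uD add1n /=; apply: leq_trans H'c _.
    have D0 : (0 < #|D|)%N by apply/card_gt0P; exists x.
    by rewrite -[in leqRHS](prednK D0) expnS mulnCA leq_mul2l Hc orbT.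
  - apply: leq_trans Dn; apply: proper_card; apply/properP; split.
      by rewrite setCS subsetUr.
    by exists u; rewrite !inE ?eqxx ?uD.
rewrite negb_exists => /forallP closed; exists D, H; split => // w u wD wuT.
apply: contraT => uD; have := closed w; rewrite wD /= negb_exists.
by move=> /forallP/(_ u); rewrite wuT uD.
Qed.

(* The components of T are peeled off one at a time; k counts them, and the
   rank #|D| - k bounds both the number of candidates and the size of T. *)
Lemma hom_cover_exists (v0 : V) T (f0 : V -> W) : injective f0 -> T \subset img_edges f0 F ->
  exists D H k rk, [/\ #|D| = (k + rk)%N, (k <= rk)%N, (s * #|T| <= M * rk)%N,
    (#|H| <= #|V| ^ k * Delta ^ rk)%N & D \subset cover T /\ hom_cover T D H].
Proof.
move=> f0_inj; have [n] := ubnP #|T|; elim: n => // n IH in T *; rewrite ltnS => Tn Tf0.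
have [T0|[e eT]] := set_0Vmem T.
  exists set0, [set [ffun=> v0]], 0%N, 0%N.
  rewrite T0 !cards0 cards1 sub0set muln0; split => //; split=> //; split=> [h w|f _ _].
    by move=> _; rewrite inE.
  by exists [ffun=> v0]; rewrite ?inE // => w; rewrite inE.
have edgeT d w : d \in T -> w \in d -> exists2 u, u != w & d = [set w; u].
  move=> /(subsetP Tf0)/imsetP[d' d'F ->] /imsetP[a ad' ->].
  have [b ba ->] := nbrsP F2 d'F ad'.
  by exists (f0 b); rewrite ?(inj_eq f0_inj) // imsetU !imset_set1.
have [x xe] : exists x, x \in e.
  have /imsetP[e' /(subsetP F2) + ->] := subsetP Tf0 _ eT.
  rewrite inE => /cards2P[a [b [_ ->]]]; exists (f0 a).
  by rewrite imset_f // !inE eqxx.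
have xT : x \in cover T by apply/bigcupP; exists e.
have [D1 [H1 [[xD1 D1T] H1P H1c closed]]] := hom_cover_component xT.
have closedD d w : d \in T -> w \in d -> w \in D1 -> d \subset D1.
  move=> dT wd wD1; have [u _ dE] := edgeT d w dT wd.
  by rewrite dE subUset !sub1set wD1 (closed w) // -dE.
pose T2 := [set d in T | [disjoint d & D1]].
have T2T : T2 \subset T by apply/subsetP => d; rewrite inE => /andP[].
have eT2 : e \notin T2.
  rewrite inE eT /=; apply/negP => /disjoint_setI0/setP/(_ x).
  by rewrite !inE xe xD1.
have T2n : (#|T2| < n)%N.
  apply: leq_trans Tn; apply: proper_card; apply/properP; split=> //.
  by exists e.
have [D2 [H2 [k [rk [D2c krk T2rk H2c [D2T H2P]]]]]] := IH T2 T2n (subset_trans T2T Tf0).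
have D12 : [disjoint D1 & D2].
  rewrite disjoint_sym disjoints_subset; apply/subsetP => w /(subsetP D2T)/bigcupP[d].
  by rewrite inE => /andP[_ dD1] wd; rewrite inE (disjointFr dD1 wd).
(* A component contains an edge, so its rank is at least 1; this is what yields [k <= rk]. *)
have D1_gt1 : (1 < #|D1|)%N.
  have [u ux eE] := edgeT e x eT xe.
  have uD1 : u \in D1 by apply: (closed x u xD1); rewrite -eE.
  apply: leq_trans (_ : #|[set x; u]| <= _)%N; first by rewrite cards2 eq_sym ux.
  by apply: subset_leq_card; rewrite subUset !sub1set xD1.
pose cmb (h : {ffun W -> V} * {ffun W -> V}) : {ffun W -> V} :=
  [ffun w => if w \in D1 then h.1 w else h.2 w].
exists (D1 :|: D2), [set cmb h | h in setX H1 H2], k.+1, (#|D1|.-1 + rk)%N; split.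
- by rewrite cardsU disjoint_setI0 // cards0 D2c; move: D1_gt1; clear; lia.
- by move: D1_gt1 krk; clear; lia.
- have T1c : (s * #|T :\: T2| <= M * #|D1|.-1)%N.
    (* The edges of [T] that meet [D1] lie inside it and come from edges of [F] inside its preimage,
       so the sparsity of [F] bounds their number by the rank of the component. *)
    pose D' := f0 @^-1: D1.
    apply: leq_trans (_ : s * #|edges_in F D'| <= _)%N.
      rewrite leq_mul2l; apply/orP; right.
      apply: leq_trans (leq_imset_card (fun d : {set V} => f0 @: d) _).
      apply/subset_leq_card/subsetP => d; rewrite !inE => /andP[dT2 dT]; move: dT2.
      rewrite dT /= => /pred0Pn[w /= /andP[wd wD1]].
      have /imsetP[d' d'F dE] := subsetP Tf0 _ dT.
      apply/imsetP; exists d' => //; rewrite inE d'F -sub_imset_pre -dE.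
      exact: closedD wd wD1.
    apply: leq_trans (sparse D') _; rewrite leq_mul2l; apply/orP; right.
    rewrite -!subn1 leq_sub2r //.
    rewrite -(card_imset _ f0_inj); apply: subset_leq_card.
    by apply/subsetP => _ /imsetP[v + ->]; rewrite inE.
  rewrite mulnDr; apply: leq_trans (leq_add T1c T2rk); rewrite -mulnDr leq_mul2l.
  by rewrite addnC -(cardsID T2 T) (setIidPr T2T) leqnn orbT.
- apply: leq_trans (leq_imset_card _ _) _; rewrite cardsX.
  by apply: leq_trans (leq_mul H1c H2c) _; rewrite expnS expnD mulnACA.
- split; last split.
  + rewrite subUset D1T; apply/subsetP=> w /(subsetP D2T)/bigcupP[d /(subsetP T2T) dT wd].
    by apply/bigcupP; exists d.
  + move=> h w /imsetP[[h1 h2]]; rewrite inE /= => /andP[h1H h2H] ->.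
    rewrite ffunE !inE /=; case: (boolP (w \in D1)) => /= [wD _|_ wD].
      by case: H1P => + _; apply.
    by case: H2P => + _; apply.
  + move=> f f_inj Tf.
    have [h1 h1H h1P] := H1P.2 f f_inj Tf.
    have [h2 h2H h2P] := H2P.2 f f_inj (subset_trans T2T Tf).
    exists (cmb (h1, h2)); first by apply/imsetP; exists (h1, h2); rewrite // inE /= h1H.
    move=> w; rewrite !inE ffunE /=; case: (boolP (w \in D1)) => /= [wD _|_ wD].
      exact: h1P.
    exact: h2P.
Qed.
End Homs.

Section Spread.
Variables (R : realFieldType) (V W I : finType) (F : {set {set V}}) (V' : {set V}).
Variables (Delta s M : nat) (J : {set I}) (phi : I -> V -> W) (n B y : R).
Hypotheses (F2 : F \subset pairs V) (FV' : forall e, e \in F -> e \subset V').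
Hypothesis deg : forall v, (#|[set e in F | v \in e]| <= Delta)%N.
Hypothesis sparse : forall D : {set V}, (s * #|edges_in F D| <= M * #|D|.-1)%N.
Hypothesis phi_inj : forall i, i \in J -> injective (phi i).
Hypotheses (D_gt0 : (0 < Delta)%N) (M_gt0 : (0 < M)%N) (V0 : (0 < #|V|)%N).
Hypotheses (Vn : #|V|%:R <= n) (B1 : 1 <= B) (y0 : 0 < y) (ny : n * y ^+ M = 1).
Hypothesis Ky1 : Delta%:R * B ^+ 2 * y <= 1.
Hypothesis point_spread : forall (D : {set W}) (h : {ffun W -> V}),
  (forall w, w \in D -> h w \in V') ->
  #|[set i in J | [forall w in D, phi i (h w) == w]]|%:R * n ^+ #|D|
    <= B ^+ #|D| * #|J|%:R.

(** Union bound over at most [n ^ k * Delta ^ rk] guesses, each right with probability at most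
    [(B / n) ^ (k + rk)]. The powers of [n] for the [k] roots cancel, and [k <= rk] leaves at most
    [(Delta * B ^ 2 / n) ^ rk]. As [1 / n] is [y ^ M] and [M * rk] is at least [s * #|T|], sparsity
    of [F] turns into spread. *)
Lemma embedding_spread (T : {set {set W}}) :
  #|[set i in J | T \subset img_edges (phi i) F]|%:R
    <= ((Delta%:R * B ^+ 2 * y) ^+ s) ^+ #|T| * #|J|%:R.
Proof.
set K := Delta%:R * B ^+ 2.
have B0 : 0 < B by apply: lt_le_trans B1.
have K1 : 1 <= K.
  by rewrite -[leLHS]mulr1 ler_pM // ?ler1n // exprn_ege1.
have K0 : 0 < K by apply: lt_le_trans K1.
have n0 : 0 < n by apply: lt_le_trans Vn; rewrite ltr0n.
set X := [set i in J | _].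
have [X0|[i0]] := set_0Vmem X.
  by rewrite X0 cards0 mulr_ge0 // !exprn_ge0 // mulr_ge0 // ltW.
rewrite inE => /andP[i0J Ti0]; have [v0 _] := card_gt0P V0.
have [D [H [k [rk [Dc krk Trk Hc [_ [HV' HP]]]]]]] :=
  hom_cover_exists F2 FV' deg sparse v0 (phi_inj i0J) Ti0.
pose Y (h : {ffun W -> V}) := [set i in J | [forall w in D, phi i (h w) == w]].
have Xle : (#|X| <= \sum_(h in H) #|Y h|)%N.
  apply: leq_trans (_ : #|\bigcup_(h in H) Y h| <= _)%N.
    apply/subset_leq_card/subsetP => i; rewrite inE => /andP[iJ Ti].
    have [h hH hP] := HP _ (phi_inj iJ) Ti.
    apply/bigcupP; exists h; rewrite // inE iJ; apply/forallP => w.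
    by apply/implyP => /hP ->.
  elim/big_rec2: _ => [|h a b hH IH]; first by rewrite cards0.
  by rewrite (leq_trans (leq_card_setU _ _)) // leq_add2l.
have le1 : #|X|%:R * n ^+ (k + rk) <= #|H|%:R * (B ^+ (k + rk) * #|J|%:R).
  apply: le_trans (_ : (\sum_(h in H) #|Y h|)%:R * n ^+ (k + rk) <= _).
    by rewrite ler_wpM2r ?ler_nat // exprn_ge0 // ltW.
  rewrite natr_sum mulr_suml mulr_natl -sumr_const; apply: ler_sum => h hH.
  by rewrite -Dc point_spread // => w wD; apply: HV'.
have le2 : #|X|%:R * n ^+ rk <= K ^+ rk * #|J|%:R.
  rewrite -(ler_pM2l (exprn_gt0 k n0)).
  apply: le_trans (_ : #|X|%:R * n ^+ (k + rk) <= _); first by rewrite exprD mulrCA.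
  apply: (le_trans le1); rewrite !mulrA; apply: ler_wpM2r => //.
  apply: le_trans (_ : n ^+ k * Delta%:R ^+ rk * B ^+ (rk + rk) <= _); last first.
    by rewrite -mulrA ler_wpM2l ?exprn_ge0 ?(ltW n0) // exprMn -exprM mul2n addnn.
  apply: ler_pM; rewrite ?exprn_ge0 ?(ltW B0) //.
    apply: le_trans (_ : (#|V| ^ k * Delta ^ rk)%:R <= _); first by rewrite ler_nat.
    rewrite natrM !natrX; apply: ler_wpM2r; first by rewrite exprn_ge0.
    by rewrite lerXn2r ?nnegrE ?(ltW n0).
  by apply: ler_weXn2l; rewrite ?leq_add2r.
have nyrk : n ^+ rk * y ^+ (M * rk) = 1 by rewrite exprM -exprMn ny expr1n.
have -> : #|X|%:R = #|X|%:R * n ^+ rk * y ^+ (M * rk) by rewrite -mulrA nyrk mulr1.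
apply: le_trans (ler_wpM2r _ le2) _; first by rewrite exprn_ge0 // ltW.
rewrite mulrAC; apply: ler_wpM2r => //.
apply: le_trans (_ : (K * y) ^+ (M * rk) <= _).
  rewrite [(K * y) ^+ _]exprMn; apply: ler_wpM2r; first by rewrite exprn_ge0 // ltW.
  by apply: ler_weXn2l => //; rewrite leq_pmull.
rewrite -exprM; apply: ler_wiXn2l => //; first by rewrite mulr_ge0 // ltW.
Qed.
End Spread.

(** * Permutations and disjoint pairs *)

Section Perms.
Variable T : finType.

Lemma perm_extend (P : {set T}) (g : T -> T) :
  {in P &, injective g} -> exists s : {perm T}, {in P, s =1 g}.
Proof.
have [n] := ubnP #|P|; elim: n => // n IH in P *; rewrite ltnS => Pn g_inj.
have [->|[x xP]] := set_0Vmem P; first by exists 1%g => x; rewrite inE.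
have [|y z|s sg] := IH (P :\ x).
- by apply: leq_trans Pn; rewrite [ltnRHS](cardsD1 x) xP.
- by rewrite !inE => /andP[_ yP] /andP[_ zP]; apply: g_inj.
exists (s * tperm (s x) (g x))%g => y yP; rewrite permM.
have [->|yx] := eqVneq y x; first by rewrite tpermL.
rewrite -(sg y) ?inE ?yx // tpermD //.
  by rewrite (inj_eq perm_inj) eq_sym.
by rewrite sg ?inE ?yx // eq_sym; apply: contraNneq yx => /g_inj ->.
Qed.

Lemma card_perm_on (A : {set T}) : #|[set s : {perm T} | perm_on A s]| = #|A|`!.
Proof. by rewrite -card_perm; apply: eq_card => s; rewrite inE. Qed.

Lemma card_perm_agree (P : {set T}) (s0 : {perm T}) :
  (#|[set s : {perm T} | [forall x in P, s x == s0 x]]| <= (#|T| - #|P|)`!)%N.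
Proof.
rewrite -[in leqRHS](setCK P) -cardsCs -card_perm -(card_imset _ (@mulIg _ s0^-1)%g).
apply/subset_leq_card/subsetP => _ /imsetP[s + ->]; rewrite inE => /forallP sP.
apply/subsetP => x; rewrite !inE; apply: contra => xP; apply/eqP.
by rewrite permM (eqP (implyP (sP x) xP)) permK.
Qed.

(** All solutions agree outside [A] and on [h @: D], which leaves at most the factorial of
    [#|A| - #|D|] of them. The targets [b] are arbitrary because a further permutation will be
    composed with [s]. *)
Lemma perm_point_spread (W : finType) (A : {set T}) (D : {set W}) (h b : W -> T) :
  (forall w, w \in D -> h w \in A) -> {in D &, injective b} ->
  (#|[set s : {perm T} | perm_on A s && [forall w in D, s (h w) == b w]]|
     * #|A| ^ #|D| <= 16 ^ #|D| * #|A|`!)%N.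
Proof.
move=> hA b_inj; set X := [set s | _].
have [->|[s0]] := set_0Vmem X; first by rewrite cards0.
rewrite inE => /andP[s0A /forallP s0h].
have h_inj : {in D &, injective h}.
  move=> w w' wD w'D hE; apply: b_inj => //.
  by rewrite -(eqP (implyP (s0h w) wD)) hE (eqP (implyP (s0h w') w'D)).
have DA : (#|D| <= #|A|)%N.
  rewrite -(card_in_imset h_inj); apply: subset_leq_card.
  by apply/subsetP => _ /imsetP[w wD ->]; apply: hA.
have Xle : (#|X| <= (#|A| - #|D|)`!)%N.
  have -> : (#|A| - #|D| = #|T| - #|~: A :|: h @: D|)%N.
    rewrite cardsU disjoint_setI0 ?cards0 ?subn0 ?(card_in_imset h_inj); last first.
      rewrite disjoint_sym disjoints_subset; apply/subsetP => _ /imsetP[w wD ->].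
      by rewrite !inE negbK hA.
    by rewrite subnDA -cardsCs.
  apply: leq_trans (card_perm_agree _ s0); apply/subset_leq_card/subsetP => s.
  rewrite !inE => /andP[sA /forallP sh]; apply/forallP => x; apply/implyP.
  rewrite !inE => /orP[xA|/imsetP[w wD ->]].
    by rewrite (out_perm sA) // (out_perm s0A).
  by rewrite (eqP (implyP (sh w) wD)) (eqP (implyP (s0h w) wD)).
apply: leq_trans (leq_mul Xle (expn_ffact DA)) _.
by rewrite mulnCA leq_mul2l mulnC ffact_fact ?leqnn ?orbT.
Qed.

End Perms.

Section DisjointPairs.
Variables (T : finType) (t : nat) (Q : {set T * T}).

(* Sequences of t vertex-disjoint elements of Q, when the elements of Q have
   their first and second components in disjoint sets. *)
Definition pair_seqs : {set {ffun 'I_t -> T * T}} :=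
  [set sg : {ffun 'I_t -> T * T} | [&& [forall j, sg j \in Q],
     injectiveb (fun j => (sg j).1) & injectiveb (fun j => (sg j).2)]].

Variable c : nat.
Hypothesis Qc : forall U1 U2 : {set T}, (#|U1| < t)%N -> (#|U2| < t)%N ->
  (c <= #|[set q in Q | (q.1 \notin U1) && (q.2 \notin U2)]|)%N.

(** Resampling entry [j]: once erased, it can be filled in at most [#|L j|] ways from [L j], but in
    at least [c] ways from [Q], since the other entries block fewer than [t] vertices on each
    side. *)
Lemma pair_seqs_step (L : 'I_t -> {set T * T}) (J : {set 'I_t}) (j : 'I_t) :
  j \notin J ->
  (#|[set sg in pair_seqs | [forall i in j |: J, sg i \in L i]]| * c
    <= #|L j| * #|[set sg in pair_seqs | [forall i in J, sg i \in L i]]|)%N.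
Proof.
move=> jJ; set A := [set sg in _ | _]; set A' := [set sg in _ | _].
pose restr (sg : {ffun 'I_t -> T * T}) : {ffun 'I_t -> option (T * T)} :=
  [ffun i => if i == j then None else Some (sg i)].
pose X := restr @: A.
have restrE sg sg' : restr sg = restr sg' -> forall i, i != j -> sg i = sg' i.
  by move=> /ffunP E i ij; have := E i; rewrite !ffunE (negbTE ij) => -[].
have AX : (#|A| <= #|X| * #|L j|)%N.
  rewrite -cardsX -(card_in_imset (f := fun sg => (restr sg, sg j)) (D := A)).
    apply/subset_leq_card/subsetP => _ /imsetP[sg sgA ->].
    rewrite inE /= imset_f //; move: sgA; rewrite inE => /andP[_ /forallP/(_ j)].
    by rewrite !inE eqxx.
  move=> sg sg' _ _ [E Ej]; apply/ffunP => i.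
  by have [->|ij] := eqVneq i j; [|apply: restrE ij].
have XA' : (#|X| * c <= #|A'|)%N.
  rewrite -sum_nat_const -[leqRHS]sum1_card.
  apply: leq_trans (_ : \sum_(sg in A' | restr sg \in X) 1 <= _)%N; last first.
    by rewrite big_mkcondr; apply: leq_sum => sg _; case: ifP.
  rewrite (partition_big restr (mem X)) /=; last by move=> sg /andP[].
  apply: leq_sum => _ /imsetP[sg0 + ->]; rewrite !inE => /andP[/and3P[sQ s1 s2] sL].
  move/forallP: sQ => sQ; move/injectiveP: s1 => s1; move/injectiveP: s2 => s2.
  move/forallP: sL => sL.
  pose U1 := [set (sg0 i).1 | i in [set~ j]]; pose U2 := [set (sg0 i).2 | i in [set~ j]].
  have cj : (#|[set~ j]| < t)%N by rewrite cardsC1 card_ord ltn_predL (leq_ltn_trans _ (ltn_ord j)).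
  have := Qc (leq_ltn_trans (leq_imset_card _ _) cj : #|U1| < t)%N
    (leq_ltn_trans (leq_imset_card _ _) cj : #|U2| < t)%N.
  move=> /leq_trans; apply; rewrite sum1_card.
  pose upd q : {ffun 'I_t -> T * T} := [ffun i => if i == j then q else sg0 i].
  have upd_inj : injective upd by move=> q q' /ffunP/(_ j); rewrite !ffunE eqxx.
  rewrite -(card_imset _ upd_inj); apply/subset_leq_card/subsetP => _ /imsetP[q + ->].
  rewrite inE => /and3P[qQ q1 q2]; rewrite unfold_in /= -andbA; apply/and3P; split.
  - rewrite inE; apply/andP; split; first rewrite inE; last first.
      apply/forallP => i; apply/implyP => iJ; rewrite ffunE.
      have := sL i; rewrite !inE iJ orbT /=; case: eqP => // ij.
      by move: jJ; rewrite -ij iJ.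
    apply/and3P; split.
    + by apply/forallP => i; rewrite ffunE; case: eqP.
    + apply/injectiveP => i i'; rewrite !ffunE.
      case: eqP => [->|/eqP ij]; case: eqP => [-> //|/eqP i'j]; last exact: s1.
        by move=> E; case/imsetP: q1; exists i'; rewrite // !inE.
      by move=> E; case/imsetP: q1; exists i; rewrite // !inE.
    + apply/injectiveP => i i'; rewrite !ffunE.
      case: eqP => [->|/eqP ij]; case: eqP => [-> //|/eqP i'j]; last exact: s2.
        by move=> E; case/imsetP: q2; exists i'; rewrite // !inE.
      by move=> E; case/imsetP: q2; exists i; rewrite // !inE.
  - rewrite (_ : restr (upd q) = restr sg0); last first.
      by apply/ffunP => i; rewrite !ffunE; case: eqP.
    apply: imset_f; rewrite !inE; apply/andP; split; last exact/forallP.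
    by apply/and3P; split; [exact/forallP|exact/injectiveP|exact/injectiveP].
  - by apply/eqP/ffunP => i; rewrite !ffunE; case: eqP.
apply: leq_trans (leq_mul AX (leqnn c)) _.
by rewrite mulnAC mulnC leq_mul2l XA' orbT.
Qed.

Lemma pair_seqs_prescribed (L : 'I_t -> {set T * T}) (J : {set 'I_t}) :
  (#|[set sg in pair_seqs | [forall i in J, sg i \in L i]]| * c ^ #|J|
    <= (\prod_(j in J) #|L j|) * #|pair_seqs|)%N.
Proof.
have [n] := ubnP #|J|; elim: n => // n IH in J *; rewrite ltnS => Jn.
have [->|[j jJ]] := set_0Vmem J.
  rewrite cards0 big_set0 muln1 mul1n; apply/subset_leq_card/subsetP => sg.
  by rewrite inE => /andP[].
have jJ' : j \notin J :\ j by rewrite !inE eqxx.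
have := pair_seqs_step L jJ'; rewrite setD1K // => le1.
have := IH (J :\ j) _; rewrite (cardsD1 j J) jJ in Jn *; move=> /(_ Jn) le2.
rewrite (bigD1 j) //= add1n expnS mulnA.
apply: leq_trans (leq_mul le1 (leqnn _)) _.
rewrite -!mulnA leq_mul2l; apply/orP; right; apply: leq_trans le2 _.
rewrite leq_mul2r; apply/orP; right; rewrite leq_eqVlt; apply/orP; left; apply/eqP.
by apply: eq_bigl => i; rewrite !inE andbC.
Qed.

(** [k w] and [b w] name the entry and the side where [w] must appear. An entry with one prescribed
    end has at most [#|T|] values, with two at most one; if [c] is of order [#|T| ^ 2], a prescribed
    end costs a factor of order [1 / #|T|]. *)
Lemma pair_seqs_point_spread (D : {set T}) (k : T -> 'I_t) (b : T -> bool) :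
  (#|[set sg in pair_seqs | [forall w in D, w == if b w then (sg (k w)).1 else (sg (k w)).2]]|
     * c ^ #|k @: D| * #|T| ^ #|D| <= #|T| ^ (2 * #|k @: D|) * #|pair_seqs|)%N.
Proof.
set X := [set sg in _ | _].
have [->|[sg0]] := set_0Vmem X; first by rewrite cards0.
rewrite inE => /andP[_ /forallP sg0D].
have kb_inj w w' : w \in D -> w' \in D -> k w = k w' -> b w = b w' -> w = w'.
  move=> wD w'D kE bE; move: (sg0D w) (sg0D w').
  by rewrite wD w'D /= kE bE => /eqP e1 /eqP e2; rewrite [LHS]e1 [RHS]e2.
pose L j := setX [set x | [forall w in D, (k w == j) && b w ==> (x == w)]]
                 [set x | [forall w in D, (k w == j) && ~~ b w ==> (x == w)]].
have LE : X \subset [set sg in pair_seqs | [forall i in k @: D, sg i \in L i]].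
  apply/subsetP => sg; rewrite !inE => /andP[-> /forallP sgD] /=.
  apply/forallP => i; apply/implyP => _; rewrite !inE; apply/andP; split.
    apply/forallP => w; apply/implyP => wD; apply/implyP => /andP[/eqP <- bw].
    by have := sgD w; rewrite wD bw /= eq_sym.
  apply/forallP => w; apply/implyP => wD; apply/implyP => /andP[/eqP <- bw].
  by have := sgD w; rewrite wD (negbTE bw) /= eq_sym.
have side j (P : pred T) : {in P &, forall w w', w \in D -> w' \in D -> k w = j -> k w' = j -> w = w'} ->
    (#|[set x | [forall w in D, (k w == j) && P w ==> (x == w)]]|
       * #|T| ^ #|[set w in D | (k w == j) && P w]| <= #|T|)%N.
  move=> Pinj; set Y := [set w in D | _].
  have [Y0|[w wY]] := set_0Vmem Y.
    by rewrite Y0 cards0 muln1 max_card.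
  have YE : Y = [set w].
    apply/setP => w'; rewrite inE; apply/idP/eqP => [w'Y|-> //]; move: wY w'Y.
    rewrite !inE => /and3P[wD /eqP kw Pw] /and3P[w'D /eqP kw' Pw'].
    exact: Pinj.
  rewrite YE cards1 expn1 -[leqRHS]mul1n leq_mul2r; apply/orP; right.
  rewrite -(cards1 w); apply/subset_leq_card/subsetP => x; rewrite !inE.
  move=> /forallP/(_ w); move: wY; rewrite !inE => /and3P[-> -> ->] /=.
  by [].
have Lj j : (#|L j| * #|T| ^ #|[set w in D | k w == j]| <= #|T| ^ 2)%N.
  rewrite cardsX (_ : #|[set w in D | k w == j]| =
    #|[set w in D | (k w == j) && b w]| + #|[set w in D | (k w == j) && ~~ b w]|)%N; last first.
    rewrite -(cardsID [set w | b w]); congr (_ + _)%N; apply: eq_card => w; rewrite !inE.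
      by rewrite andbA.
    by rewrite andbC andbA.
  rewrite expnD mulnACA; apply: leq_mul; apply: side.
    by move=> w w' bw bw' wD w'D kw kw'; apply: kb_inj; rewrite ?kw ?kw' //; move: bw bw'; rewrite !unfold_in => -> ->.
  by move=> w w' bw bw' wD w'D kw kw'; apply: kb_inj; rewrite ?kw ?kw' //; move: bw bw'; rewrite !unfold_in => /negbTE-> /negbTE->.
have := pair_seqs_prescribed L (k @: D).
move=> /(leq_trans (leq_mul (subset_leq_card LE) (leqnn _))) le1.
apply: leq_trans (leq_mul le1 (leqnn _)) _.
rewrite mulnAC leq_mul2r; apply/orP; right.
have -> : #|D| = (\sum_(j in k @: D) #|[set w in D | k w == j]|)%N.
  rewrite -sum1_card (partition_big_imset k) /=; apply: eq_bigr => j _.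
  by rewrite -sum1_card; apply: eq_bigl => w; rewrite inE.
rewrite expn_sum mulnC -big_split /= expnM -prod_nat_const.
by apply: leq_prod => j _; rewrite mulnC.
Qed.

End DisjointPairs.

(** * Cliques and near tilings *)

Definition is_clique (V : finType) (F : {set {set V}}) (C : {set V}) : bool :=
  [forall x in C, forall y in C, (x != y) ==> ([set x; y] \in F)].

Definition cliques (V : finType) (F : {set {set V}}) (r : nat) : {set {set V}} :=
  [set C : {set V} | (#|C| == r) && is_clique F C].

Lemma is_cliqueP (V : finType) (F : {set {set V}}) (C : {set V}) :
  reflect {in C &, forall x y, x != y -> [set x; y] \in F} (is_clique F C).
Proof.
apply: (iffP forall_inP) => [clC x y xC yC xy|clC x xC].
  by have /forall_inP/(_ y yC)/implyP := clC x xC; apply.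
by apply/forall_inP => y yC; apply/implyP => xy; apply: clC.
Qed.

Section Sparse.
Variables (V : finType) (F : {set {set V}}) (Delta : nat).
Hypotheses (F2 : F \subset pairs V).
Hypothesis deg : forall v, (#|[set e in F | v \in e]| <= Delta)%N.
Implicit Types (C D : {set V}).

Lemma handshake D : (2 * #|edges_in F D| <= Delta * #|D|)%N.
Proof.
have -> : (2 * #|edges_in F D| = \sum_(e in edges_in F D) \sum_(v in D) (v \in e))%N.
  rewrite mulnC -sum_nat_const; apply: eq_bigr => e; rewrite inE => /andP[eF eD].
  have := subsetP F2 e eF; rewrite inE => /eqP <-.
  rewrite -card_set_sum; apply: eq_card => v; rewrite !inE.
  by case: (boolP (v \in e)) => [/(subsetP eD) ->|_]; rewrite ?andbF.
rewrite exchange_big mulnC -sum_nat_const; apply: leq_sum => v vD /=.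
rewrite -card_set_sum; apply: leq_trans (deg v); apply/subset_leq_card/subsetP => e.
by rewrite !inE => /andP[/andP[-> _] ->].
Qed.

Definition pairs_in D : {set {set V}} := [set e : {set V} | (e \subset D) && (#|e| == 2%N)].

Lemma card_pairs_in D : (2 * #|pairs_in D| = #|D| * #|D|.-1)%N.
Proof. by rewrite /pairs_in cards_draws -[2%N]/(2`!) mulnC bin_ffact ffactnS ffactn1. Qed.

Lemma edges_in_pairs D : edges_in F D \subset pairs_in D.
Proof.
apply/subsetP => e; rewrite !inE => /andP[eF ->] /=.
by have := subsetP F2 e eF; rewrite inE.
Qed.

(** Counting pairs is enough up to [Delta.+1] vertices, the handshake bound beyond; a clique on
    [Delta.+1] vertices gives equality. *)
Lemma sparse_degree D : (2 * #|edges_in F D| <= Delta.+1 * #|D|.-1)%N.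
Proof.
have h1 := handshake D; have h2 := card_pairs_in D.
have := subset_leq_card (edges_in_pairs D).
set e := #|edges_in F D| in h1 *; set v := #|D| in h1 h2 *; set q := #|_| in h2 * => eq.
case: v h1 h2 => [|v] /= h1 h2; first lia.
case: (leqP v Delta) => [le|lt]; last by nia.
by nia.
Qed.

Hypothesis noclique : cliques F Delta.+1 = set0.

(** The same two counts stay below the ratio [Delta.+1 / 2] except on [Delta.+1] vertices, where the
    absence of a clique means a missing pair. The constant [Delta.+1 ^ 2 - 1] is what the handshake
    bound gives on [Delta.+2] vertices. *)
Lemma sparse_cliquefree D : (1 < Delta)%N ->
  (2 * Delta.+1 * #|edges_in F D| <= (Delta.+1 ^ 2 - 1) * #|D|.-1)%N.
Proof.
move=> Delta1; have h1 := handshake D; have h2 := card_pairs_in D.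
have := subset_leq_card (edges_in_pairs D).
have strict : #|D| = Delta.+1 -> (#|edges_in F D| < #|pairs_in D|)%N.
  move=> Dr; apply: proper_card; rewrite properEneq edges_in_pairs andbT.
  apply/eqP => E; suff : D \in cliques F Delta.+1 by rewrite noclique inE.
  rewrite inE Dr eqxx; apply/is_cliqueP => x y xD yD xy.
  have : [set x; y] \in edges_in F D by rewrite E inE subUset !sub1set xD yD cards2 xy.
  by rewrite inE => /andP[].
set e := #|edges_in F D| in h1 strict *; set v := #|D| in h1 h2 strict *.
set q := #|_| in h2 strict * => eq.
have -> : (Delta.+1 ^ 2 - 1 = Delta * Delta.+2)%N by nia.
case: v h1 h2 strict => [|v] /= h1 h2 strict; first lia.
have [lt|lt|vE] := ltngtP v Delta.
- by nia.
- by nia.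
by subst v; have := strict erefl; nia.
Qed.

End Sparse.

Section Cliques.
Variables (V : finType) (F : {set {set V}}) (Delta : nat).
Hypotheses (F2 : F \subset pairs V).
Hypothesis deg : forall v, (#|[set e in F | v \in e]| <= Delta)%N.
Implicit Types (C D : {set V}).

(** A vertex of the clique has [Delta] neighbours inside it, hence none outside: such cliques are
    components. *)
Lemma clique_nbrs C v : C \in cliques F Delta.+1 -> v \in C -> C = v |: nbrs F v.
Proof.
rewrite inE => /andP[/eqP Cr /is_cliqueP clC] vC.
rewrite -{1}(setD1K vC); congr (_ |: _); apply/eqP; rewrite eqEcard; apply/andP; split.
  by apply/subsetP => u; rewrite !inE => /andP[uv uC]; rewrite clC // eq_sym.
by rewrite card_nbrs // (leq_trans (deg v)) // -ltnS -Cr (cardsD1 v C) vC.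
Qed.

Lemma trivIset_cliques : trivIset (cliques F Delta.+1).
Proof.
apply/trivIsetP => C C' CF C'F; apply: contraR => /pred0Pn[v /= /andP[vC vC']].
by rewrite (clique_nbrs CF vC) -(clique_nbrs C'F vC').
Qed.

Lemma edge_clique C e v : C \in cliques F Delta.+1 -> e \in F -> v \in e -> v \in C ->
  e \subset C.
Proof.
move=> CF eF ve vC; have [u uv eE] := nbrsP F2 eF ve.
rewrite eE subUset !sub1set vC (clique_nbrs CF vC) !inE -eE eF orbT.
by [].
Qed.

End Cliques.

Section Families.
Variable V : finType.
Implicit Types (A C : {set V}) (P Q : {set {set V}}).

Lemma trivIset_exists A r k : (0 < r)%N -> (k * r <= #|A|)%N ->
  exists P, [/\ trivIset P, #|P| = k & forall C, C \in P -> C \subset A /\ #|C| = r].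
Proof.
move=> r0; elim: k A => [|k IH] A; first by exists set0; split;
  [apply/trivIsetP => C C'; rewrite inE | rewrite cards0 | move=> C; rewrite inE].
rewrite mulSn => rA; pose C := [set x in take r (enum A)].
have CA : C \subset A.
  by apply/subsetP => x; rewrite inE => /mem_take; rewrite mem_enum.
have Cr : #|C| = r.
  rewrite cardsE (card_uniqP _) ?take_uniq ?enum_uniq // size_takel // -cardE.
  by apply: leq_trans rA; rewrite leq_addr.
have [|P [Ptriv Pk PA]] := IH (A :\: C).
  by rewrite cardsD (setIidPr CA) Cr; lia.
have CP C' : C' \in P -> [disjoint C' & C].
  by move=> /PA[C'A _]; rewrite disjoints_subset; apply: subset_trans C'A (subsetDr _ _).
exists (C |: P); split.
- apply/trivIsetP => C1 C2; rewrite !inE => /orP[/eqP->|C1P] /orP[/eqP->|C2P].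
  + by rewrite eqxx.
  + by move=> _; rewrite disjoint_sym CP.
  + by move=> _; rewrite CP.
  + exact: (trivIsetP Ptriv).
- rewrite cardsU1 Pk; suff -> : C \notin P by [].
  apply/negP => /CP /disjoint_setI0; rewrite setIid => C0.
  by rewrite C0 cards0 in Cr; rewrite -Cr in r0.
- move=> C'; rewrite !inE => /orP[/eqP-> //|/PA[C'A ->]]; split=> //.
  exact: subset_trans C'A (subsetDl _ _).
Qed.

(** Blocks are matched in enumeration order and, within a block, elements by position. This will
    carry clique components of the graph onto cliques found in the random graph. *)
Lemma trivIset_map P Q r : trivIset P -> trivIset Q -> (#|P| <= #|Q|)%N ->
  (forall C, C \in P -> #|C| = r) -> (forall C, C \in Q -> #|C| = r) ->
  exists g : V -> V, {in cover P &, injective g} /\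
    forall C, C \in P -> exists2 C', C' \in Q & {in C, forall v, g v \in C'}.
Proof.
move=> Pt Qt PQ Pr Qr.
pose blk C := nth set0 (enum Q) (index C (enum P)).
have blkQ C : C \in P -> blk C \in Q.
  move=> CP; rewrite -mem_enum mem_nth // -cardE (leq_trans _ PQ) //.
  by rewrite cardE index_mem mem_enum.
have blk_inj : {in P &, injective blk}.
  move=> C C' CP C'P /eqP; rewrite nth_uniq ?enum_uniq -?cardE //.
  - by move/eqP/(congr1 (nth set0 (enum P))); rewrite !nth_index ?mem_enum.
  - by rewrite (leq_trans _ PQ) // cardE index_mem mem_enum.
  - by rewrite (leq_trans _ PQ) // cardE index_mem mem_enum.
pose g v := nth v (enum (blk (pblock P v))) (index v (enum (pblock P v))).
have ltg C v : C \in P -> v \in C -> (index v (enum C) < size (enum (blk C)))%N.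
  by move=> CP vC; rewrite -cardE Qr ?blkQ // -(Pr C CP) cardE index_mem mem_enum.
have gblk C v : C \in P -> v \in C -> g v \in blk C.
  by move=> CP vC; rewrite /g (def_pblock Pt CP vC) -mem_enum mem_nth ?ltg.
exists g; split=> [u v /bigcupP[C CP uC] /bigcupP[C' C'P vC'] gE|C CP]; last first.
  by exists (blk C) => [|v vC]; rewrite ?blkQ ?gblk.
have CC' : C = C'.
  apply: blk_inj => //; apply: contraTeq isT => ne.
  have := trivIsetP Qt _ _ (blkQ C CP) (blkQ C' C'P) ne.
  by move/disjoint_setI0/setP/(_ (g u)); rewrite !inE gblk // gE gblk.
subst C'; move: gE; rewrite /g !(def_pblock Pt CP) //.
rewrite (set_nth_default u v) ?ltg // => /eqP.
rewrite nth_uniq ?ltg ?enum_uniq // => /eqP /(congr1 (nth u (enum C))).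
by rewrite !nth_index ?mem_enum.
Qed.

End Families.

Definition has_cliques (T : finType) (A : {set T}) (r g : nat) (W : {set {set T}}) : bool :=
  [exists Q : {set {set T}}, [&& trivIset Q, (g <= #|Q|)%N &
    [forall C in Q, (C \subset A) && (C \in cliques W r)]]].

Lemma card_img_edges (V W : finType) (f : V -> W) (F : {set {set V}}) :
  (#|img_edges f F| <= #|F|)%N.
Proof. exact: leq_imset_card. Qed.

Lemma img_edges_pairs (V W : finType) (f : V -> W) (F : {set {set V}}) :
  injective f -> F \subset pairs V -> img_edges f F \subset pairs W.
Proof.
move=> f_inj /subsetP F2; apply/subsetP => _ /imsetP[e /F2 + ->].
by rewrite !inE card_imset.
Qed.

Section NearTiling.
Variables (R : realFieldType) (T : finType) (A : {set T}) (Delta k0 : nat) (y mu : R).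
Let r := Delta.+1.
Let M := (r * (r ^ 2 - 1))%N.
Let K : R := Delta%:R * 32%:R ^+ 2.
Hypotheses (Delta1 : (1 < Delta)%N) (k0A : (k0 * r <= #|A|)%N) (A2 : (#|T| <= 2 * #|A|)%N).
Hypotheses (T0 : (0 < #|T|)%N) (y0 : 0 < y) (ny : #|T|%:R * y ^+ M = 1) (Ky : K * y <= 1).
Hypotheses (mu0 : 0 < mu <= 1 / 8).
Let p := (K * y) ^+ (2 * (r ^ 2 - 1)) / mu ^+ 2.
Hypothesis p1 : p <= 1.

(** The family consists of the images of [k0] fixed disjoint cliques under the permutations
    supported on [A]. Its spread is [p * mu ^+ 2], so one round leaves some member with at most
    [Delta * #|T| * mu] missing edges, each of which spoils at most one clique. *)
Lemma Ex_near_tiling (g k : nat) :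
  k%:R <= Delta%:R * #|T|%:R * mu -> g%:R + Delta%:R * #|T|%:R * mu <= k0%:R ->
  1 - 4 * (4 * mu) ^+ k.+1 <= Ex (pairs T) p (fun W => (has_cliques A r g W)%:R).
Proof.
move=> kL gk0; have [P [Pt Pk PA]] := @trivIset_exists T A r k0 isT k0A.
pose F := [set e in pairs T | [exists C in P, e \subset C]].
have F2 : F \subset pairs T by apply/subsetP => e; rewrite inE => /andP[].
have FA e : e \in F -> e \subset A.
  rewrite inE => /andP[_ /existsP[C /andP[CP eC]]].
  by apply: subset_trans eC _; case: (PA C CP).
have deg v : (#|[set e in F | v \in e]| <= Delta)%N.
  rewrite -card_nbrs //; have [->|[u uv]] := set_0Vmem (nbrs F v); first by rewrite cards0.
  have Fblk w : w \in nbrs F v -> exists2 C, C \in P & (v \in C) && (w \in C).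
    rewrite !inE => /andP[_ /existsP[C /andP[CP]]].
    by rewrite subUset !sub1set => vwC; exists C.
  have [C CP /andP[vC uC]] := Fblk u uv.
  have [_ Cr] := PA C CP; rewrite (cardsD1 v C) vC add1n in Cr; case: Cr => <-.
  apply/subset_leq_card/subsetP => w wv; rewrite !inE; apply/andP; split.
    by apply: contraTneq wv => ->; apply: nbrs_irr.
  have [C' C'P /andP[vC' wC']] := Fblk w wv.
  by rewrite -(def_pblock Pt CP vC) (def_pblock Pt C'P vC').
have sparse D : ((2 * (r ^ 2 - 1)) * #|edges_in F D| <= M * #|D|.-1)%N.
  by rewrite mulnAC mulnC /M [(r * _)%N]mulnC -!mulnA leq_mul2l sparse_degree ?orbT.
pose J := [set s : {perm T} | perm_on A s].
pose S (s : {perm T}) := img_edges s F.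
have J0 : 0 < #|J|%:R :> R by rewrite ltr0n card_perm_on fact_gt0.
have spread (X : {set {set T}}) : #|[set s in J | X \subset S s]|%:R
    <= ((K * y) ^+ (2 * (r ^ 2 - 1))) ^+ #|X| * #|J|%:R.
  apply: (@embedding_spread R T T {perm T} F A Delta (2 * (r ^ 2 - 1)) M J (fun s => s)
    #|T|%:R 32%:R y) => //.
  - by move=> s _; apply: perm_inj.
  - exact: ltnW.
  - by rewrite /M muln_gt0 /= subn_gt0 sqr_gt1 // ltnS ltnW.
  - by rewrite ler1n.
  (* The constant 32 is the 16 of prescribed permutation values, doubled because [#|T|] may be twice
     [#|A|]. *)
  move=> D h hA; rewrite -!natrX -!natrM ler_nat.
  apply: leq_trans (_ : #|[set s in J | [forall w in D, s (h w) == w]]|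
      * (2 * #|A|) ^ #|D| <= _)%N; first by rewrite leq_mul2l leq_exp_base ?orbT.
  have := @perm_point_spread T T A D h id hA (in2W (fun _ _ => id)).
  rewrite card_perm_on (_ : [set s in [set s | _] | _] =
    [set s : {perm T} | perm_on A s && [forall w in D, s (h w) == w]]); last first.
    by apply/setP => s; rewrite !inE.
  by rewrite (_ : 32 = 2 * 16)%N // !expnMn mulnCA -mulnA leq_mul2l => ->; rewrite orbT.
have K0 : 0 < K by rewrite mulr_gt0 ?exprn_gt0 ?ltr0n // ltnW.
have [mu_gt0 mu8] := andP mu0.
have p0 : 0 < p by rewrite divr_gt0 ?exprn_gt0 // mulr_gt0.
have p01 : 0 < p <= 1 by rewrite p0.
have L0 : 0 <= Delta%:R * #|T|%:R :> R by rewrite -natrM.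
have := @exists_small_fragments R _ _ (pairs T) S J p ((K * y) ^+ (2 * (r ^ 2 - 1)))
  (Delta%:R * #|T|%:R) #|J|%:R mu (1 / 2) k p01 J0 L0 _ _ _ kL _ _ _ spread _.
rewrite (ltW mu_gt0) mu8 exprn_ge0 ?mulr_ge0 ?(ltW K0) ?(ltW y0) //.
rewrite /p divfK ?lexx ?expf_neq0 ?(gt_eqF mu_gt0) //.
move=> /(_ isT isT isT _); have half0 : 0 < 1 / 2 :> R by lra.
have SL i : i \in J -> #|S i|%:R <= Delta%:R * #|T|%:R :> R.
  move=> _; rewrite -natrM ler_nat (leq_trans (card_img_edges _ _)) //.
  have := handshake F2 deg setT; rewrite /edges_in cardsT.
  rewrite (_ : [set e in F | _] = F).
    by apply: leq_trans; rewrite leq_pmull.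
  by apply/setP => e; rewrite !inE subsetT andbT.
have SE i : i \in J -> S i \subset pairs T.
  by move=> _; apply: img_edges_pairs F2; apply: perm_inj.
have J2 : 2 * (1 / 2) * #|J|%:R <= #|J|%:R :> R by lra.
move=> /(_ half0 SE SL J2).
rewrite (_ : 2 * (4 * mu) ^+ k.+1 / (1 / 2) = 4 * (4 * mu) ^+ k.+1); last by field.
move=> /le_trans; apply; rewrite -/p; apply: le_Ex => [|W _]; first by rewrite (ltW p0).
rewrite ler_nat; case: (boolP (_ <= _)) => // large.
have [i] : exists i, i \in [set i in J | #|fragment S J W i|%:R <= Delta%:R * #|T|%:R * mu].
  apply/set0Pn; rewrite -card_gt0 -(ltr_nat R); apply: lt_le_trans large.
  by rewrite mulr_gt0.
rewrite inE => /andP[iJ fi]; have [s [sJ _ fE _]] := fragmentP S W iJ.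
move: fi; rewrite fE => missing.
have sA : perm_on A s by move: sJ; rewrite inE.
suff -> : has_cliques A r g W by [].
pose good := [set C in P | s @: C \in cliques W r].
have s_im_inj : injective (fun C : {set T} => s @: C) by apply: imset_inj; apply: perm_inj.
apply/existsP; exists [set s @: (C : {set T}) | C in good]; apply/and3P; split.
- apply/trivIsetP => _ _ /imsetP[C1 C1g ->] /imsetP[C2 C2g ->] ne.
  rewrite -setI_eq0 -imsetI; last by move=> ? ? _ _; apply: perm_inj.
  rewrite imset_eq0 setI_eq0; apply: (trivIsetP Pt).
  + by move: C1g; rewrite inE => /andP[].
  + by move: C2g; rewrite inE => /andP[].
  + by apply: contraNneq ne => ->.
- rewrite card_imset //.
  have bad C : C \in P :\: good -> exists2 e, e \in S s :\: W & e \subset s @: C.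
    rewrite !inE => /andP[ng CP]; move: ng; rewrite CP /= card_imset; last exact: perm_inj.
    have [CA ->] := PA C CP; rewrite eqxx /= => /is_cliqueP ng.
    have [/forall_inP all|] := boolP [forall e in pairs_in C, s @: e \in W].
      case: ng => _ _ /imsetP[u uC ->] /imsetP[v vC ->] uv.
      have := all [set u; v]; rewrite imsetU !imset_set1; apply.
      by rewrite inE subUset !sub1set uC vC cards2 -(inj_eq (@perm_inj _ s)) uv.
    rewrite negb_forall => /existsP[e]; rewrite negb_imply inE => /andP[/andP[eC e2] eW].
    exists (s @: e); last exact: imsetS.
    rewrite inE eW; apply: imset_f; rewrite !inE e2; apply/existsP; exists C.
    by rewrite CP.
  have cardbad : (#|P :\: good| <= #|S s :\: W|)%N.
    (* One missing edge is chosen in each spoiled clique; the cliques being disjoint, these edges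
       are distinct. *)
    pose pk (C : {set T}) := odflt set0 [pick e in S s :\: W | e \subset s @: C].
    have pkP C : C \in P :\: good -> pk C \in S s :\: W /\ pk C \subset s @: C.
      move=> /bad[e eS eC]; rewrite /pk; case: pickP => [e' /andP[] //|/(_ e)].
      by rewrite eS eC.
    rewrite -(card_in_imset (f := pk)).
      by apply/subset_leq_card/subsetP => _ /imsetP[C CP ->]; case: (pkP C CP).
    move=> C C' Cb C'b E; have [pS pC] := pkP C Cb; have [_ pC'] := pkP C' C'b.
    have CP : C \in P by move: Cb; rewrite inE => /andP[].
    have C'P : C' \in P by move: C'b; rewrite inE => /andP[].
    have /set0Pn[w wp] : pk C != set0.
      have : pk C \in pairs T by apply: subsetP (SE s sJ) _ _; move: pS; rewrite inE => /andP[].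
      by rewrite inE -card_gt0 => /eqP ->.
    have /imsetP[u uC wu] := subsetP pC _ wp.
    rewrite E in wp; have /imsetP[u' uC' wu'] := subsetP pC' _ wp.
    have uu' : u = u' by apply: (@perm_inj _ s); rewrite -wu.
    by rewrite -(def_pblock Pt CP uC) uu' (def_pblock Pt C'P uC').
  rewrite -(ler_nat R); have gP : good \subset P by apply/subsetP => C; rewrite inE => /andP[].
  have := cardsID good P; rewrite (setIidPr gP) Pk => k0E.
  move: gk0 missing cardbad; rewrite -k0E natrD -(ler_nat R); lra.
- apply/forall_inP => D /imsetP[C]; rewrite inE => /andP[CP sC] ->; rewrite sC andbT.
  have [CA _] := PA C CP; apply/subsetP => _ /imsetP[v vC ->].
  by rewrite perm_closed // (subsetP CA).
Qed.

End NearTiling.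

(** * Dense pairs *)

Section Density.
Variables (R : realFieldType) (T : finType) (q : rel T).
Implicit Types (A B : {set T}) (a b u k : nat).

(** Removing an element of least value never lowers the average of [f]; this is repeated until [a]
    elements remain. *)
Lemma dense_subset (f : T -> nat) A a : (a <= #|A|)%N ->
  exists2 A' : {set T}, (A' \subset A) && (#|A'| == a) &
    ((\sum_(x in A) f x) * a <= (\sum_(x in A') f x) * #|A|)%N.
Proof.
have [m] := ubnP (#|A| - a)%N; elim: m => // m IH in A *; rewrite ltnS => Am aA.
have [Aa|Aa] := eqVneq #|A| a; first by exists A; rewrite ?subxx Aa ?eqxx.
have lt : (a < #|A|)%N by rewrite ltn_neqAle eq_sym Aa.
have [x xA xmin] : exists2 x, x \in A & (f x * #|A| <= \sum_(x in A) f x)%N.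
  have [x0 x0A] : exists x0, x0 \in A by apply/card_gt0P; apply: leq_ltn_trans lt.
  case: (@arg_minnP _ x0 (mem A) f x0A) => x xA xmin; exists x => //.
  by rewrite mulnC -sum_nat_const; apply: leq_sum.
have Ax : #|A| = #|A :\ x|.+1 by rewrite (cardsD1 x) xA.
have [||A' /andP[A'A A'a] le] := IH (A :\ x).
- by move: Am lt; rewrite Ax; clear; lia.
- by move: lt; rewrite Ax ltnS.
exists A'; first by rewrite A'a andbT (subset_trans A'A) // subsetDl.
rewrite (big_setD1 x xA) /= in xmin *; rewrite Ax.
move: xmin le lt; rewrite Ax; set s := (\sum_(i in A :\ x) _)%N; set c := #|A :\ x|.
set s' := (\sum_(i in A') _)%N; move: (f x) => fx xmin le lt.
have [c0|c0] := posnP c.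
  have -> : a = 0%N by move: lt; rewrite c0; case: (a).
  by rewrite muln0.
have fxc : (fx * c <= s)%N by move: xmin; rewrite mulnS leq_add2l.
rewrite -(leq_pmul2r c0).
apply: leq_trans (_ : s * a * c.+1 <= _)%N.
  rewrite mulnAC [leqRHS]mulnAC leq_mul2r; apply/orP; right.
  by rewrite mulnDl mulnS leq_add2r.
by rewrite [leqRHS]mulnAC leq_mul2r le orbT.
Qed.

Definition links A B : nat := (\sum_(x in A) \sum_(y in B) q x y)%N.

Lemma linksE A B : links A B = (\sum_(y in B) \sum_(x in A) q x y)%N.
Proof. exact: exchange_big. Qed.

Lemma dense_subpair A B a b : (a <= #|A|)%N -> (b <= #|B|)%N ->
  exists A' B', [/\ A' \subset A, B' \subset B, #|A'| = a, #|B'| = b &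
    (links A B * (a * b) <= links A' B' * (#|A| * #|B|))%N].
Proof.
move=> aA bB.
have [A' /andP[A'A /eqP A'a] leA] := dense_subset (fun x => \sum_(y in B) q x y)%N aA.
have [B' /andP[B'B /eqP B'b] leB] := dense_subset (fun y => \sum_(x in A') q x y)%N bB.
exists A', B'; split=> //; move: leA leB; rewrite -!linksE -/(links A B) -/(links A' B).
move=> leA leB; rewrite mulnA; apply: leq_trans (leq_mul leA (leqnn b)) _.
by rewrite mulnAC [leqRHS]mulnA [leqRHS]mulnAC leq_mul2r leB orbT.
Qed.

Lemma links_le A B : (links A B <= #|A| * #|B|)%N.
Proof.
rewrite -sum_nat_const; apply: leq_sum => x _; rewrite -sum1_card.
by apply: leq_sum => y _; apply: leq_b1.
Qed.

Lemma linksS A A' B B' : A' \subset A -> B' \subset B -> (links A' B' <= links A B)%N.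
Proof.
move=> A'A B'B; rewrite /links [leqRHS](big_setID A') /= (setIidPr A'A).
apply: leq_trans (leq_addr _ _); apply: leq_sum => x _.
by rewrite [leqRHS](big_setID B') /= (setIidPr B'B) leq_addr.
Qed.

Lemma links_split A A' B B' : A' \subset A -> B' \subset B ->
  links A B = (links A' B' + links A' (B :\: B') + links (A :\: A') B)%N.
Proof.
move=> A'A B'B; rewrite /links (big_setID A') /= (setIidPr A'A) -big_split /=.
congr (_ + _)%N; apply: eq_bigr => x _.
by rewrite (big_setID B') /= (setIidPr B'B).
Qed.

Lemma subset_card_exists A a : (a <= #|A|)%N ->
  exists2 A' : {set T}, A' \subset A & #|A'| = a.
Proof.
by case/(dense_subset (fun=> 0%N)) => A' /andP[A'A /eqP]; exists A'.
Qed.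

(* If a pair of density d has a sparse pair of quarters, then the density of one
   of the other parts is at least 31/30 d; this can happen only k times. *)
Lemma dense_pair_exists (c : R) k : c <= (30 / 31) ^+ k / 64 -> forall A B b,
  (0 < b)%N -> #|A| = (4 ^ k.+1 * b)%N -> #|B| = (4 ^ k.+1 * b)%N ->
  (30 / 31) ^+ k * (#|A| * #|B|)%:R <= (links A B)%:R :> R ->
  exists u A' B', [/\ (b <= u <= 4 ^ k * b)%N, A' \subset A /\ B' \subset B,
    #|A'| = (4 * u)%N, #|B'| = (4 * u)%N &
    forall A1 B1, A1 \subset A' -> B1 \subset B' -> (u <= #|A1|)%N -> (u <= #|B1|)%N ->
      c * (u ^ 2)%:R <= (links A1 B1)%:R].
Proof.
have step d A B u : 0 < d -> c <= d / 64 -> (0 < u)%N ->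
    #|A| = (4 * u)%N -> #|B| = (4 * u)%N -> d * (#|A| * #|B|)%:R <= (links A B)%:R ->
    (forall A1 B1, A1 \subset A -> B1 \subset B -> (u <= #|A1|)%N -> (u <= #|B1|)%N ->
      c * (u ^ 2)%:R <= (links A1 B1)%:R) \/
    exists A' B', [/\ A' \subset A, B' \subset B, #|A'| = u, #|B'| = u &
      31 / 30 * d * (u * u)%:R <= (links A' B')%:R].
  move=> d0 cd u0 cA cB dAB.
  have [/forall_inP all|] := boolP [forall A1 in [set A1 : {set T} | (A1 \subset A) && (u <= #|A1|)%N],
    forall B1 in [set B1 : {set T} | (B1 \subset B) && (u <= #|B1|)%N], c * (u ^ 2)%:R <= (links A1 B1)%:R].
    left=> A1 B1 A1A B1B uA1 uB1.
    by have := all A1; rewrite inE A1A uA1 => /(_ isT)/forall_inP; apply; rewrite inE B1B.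
  rewrite negb_forall => /existsP[A0]; rewrite negb_imply inE => /andP[/andP[A0A uA0]].
  rewrite negb_forall => /existsP[B0]; rewrite negb_imply inE => /andP[/andP[B0B uB0]].
  rewrite -real_ltNge ?num_real // => lt0; right.
  have [A1 A1A0 cA1] := subset_card_exists uA0; have [B1 B1B0 cB1] := subset_card_exists uB0.
  have A1A := subset_trans A1A0 A0A; have B1B := subset_trans B1B0 B0B.
  have lt1 : (links A1 B1)%:R < c * (u ^ 2)%:R.
    by apply: le_lt_trans lt0; rewrite ler_nat linksS.
  have cA2 : #|A :\: A1| = (3 * u)%N.
    by rewrite cardsD (setIidPr A1A) cA cA1 -[X in (_ - X)%N]mul1n -mulnBl.
  have cB2 : #|B :\: B1| = (3 * u)%N.
    by rewrite cardsD (setIidPr B1B) cB cB1 -[X in (_ - X)%N]mul1n -mulnBl.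
  have uu0 : 0 < (u * u)%:R :> R by rewrite ltr0n muln_gt0 u0.
  have sub A3 B3 a b : A3 \subset A -> B3 \subset B -> #|A3| = (a.+1 * u)%N ->
      #|B3| = (b.+1 * u)%N ->
      31 / 30 * d * (a.+1%:R * b.+1%:R * (u * u)%:R) <= (links A3 B3)%:R ->
      exists A' B', [/\ A' \subset A, B' \subset B, #|A'| = u, #|B'| = u &
      31 / 30 * d * (u * u)%:R <= (links A' B')%:R].
    move=> A3A B3B cA3 cB3 le.
    have uA3 : (u <= #|A3|)%N by rewrite cA3 leq_pmull.
    have uB3 : (u <= #|B3|)%N by rewrite cB3 leq_pmull.
    have [A' [B' [A'A3 B'B3 cA' cB' le']]] := dense_subpair uA3 uB3.
    exists A', B'; split=> //; [exact: subset_trans A3A|exact: subset_trans B3B|].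
    have ab0 : 0 < a.+1%:R * b.+1%:R * (u * u)%:R :> R by rewrite !mulr_gt0 // ltr0n.
    rewrite -(ler_pM2r ab0).
    move: le'; rewrite cA3 cB3 -(ler_nat R) => le'.
    apply: le_trans (_ : (links A3 B3)%:R * (u * u)%:R <= _).
      by rewrite mulrAC ler_pM2r.
    rewrite -natrM; apply: (le_trans le'); rewrite -!natrM ler_nat.
    by rewrite mulnACA.
  case: (lerP (31 / 30 * d * (1%:R * 3%:R * (u * u)%:R)) (links A1 (B :\: B1))%:R) => h1.
    apply: (sub A1 (B :\: B1) 0%N 2) => //; last by rewrite mul1n.
    exact: subset_trans (subsetDl _ _) _.
  case: (lerP (31 / 30 * d * (3%:R * 4%:R * (u * u)%:R)) (links (A :\: A1) B)%:R) => h2.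
    by apply: (sub (A :\: A1) B 2 3) => //; apply: subset_trans (subsetDl _ _) _.
  (* In units of [u ^ 2] the pair carries at least [16 * d] links, but the sparse quarter has fewer
     than [d / 64], and the parts of sizes 3 and 12 together fewer than [31 / 30 * 15 * d], that is
     [15.5 * d]. *)
  exfalso; move: dAB; rewrite (links_split A1A B1B) !natrD cA cB mulnACA natrM => dAB.
  have cu : c * (u * u)%:R <= d / 64 * (u * u)%:R by rewrite ler_pM2r.
  have du : 0 < d * (u * u)%:R by rewrite mulr_gt0.
  by move: lt1 h1 h2 dAB cu du; rewrite -mulnn; clear; set z := (u * u)%:R; set l1 := (links _ _)%:R; set l2 := (links _ _)%:R; set l3 := (links _ _)%:R; nra.
elim: k => [|k IH] cle A B b b0 cA cB dAB.
  have u0 : (0 < b)%N by [].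
  rewrite expr0 in cle dAB.
  have [all|[A' [B' [A'A B'B cA' cB' le]]]] := step 1 A B b ltr01 cle u0 cA cB dAB.
    by exists b, A, B; rewrite expn0 mul1n leqnn.
  (* Starting from density 1, an increment would exceed the largest possible density. *)
  have := links_le A' B'; rewrite cA' cB' -(ler_nat R) => le2.
  have bb : 0 < (b * b)%:R :> R by rewrite ltr0n muln_gt0 b0.
  by exfalso; move: le le2 bb; clear; set z := (b * b)%:R; lra.
have u0 : (0 < 4 ^ k.+1 * b)%N by rewrite muln_gt0 expn_gt0.
have d0 : 0 < (30 / 31) ^+ k.+1 :> R by rewrite exprn_gt0 // divr_gt0 ?ltr0n.
have cA4 : #|A| = (4 * (4 ^ k.+1 * b))%N by rewrite cA mulnA -expnS.
have cB4 : #|B| = (4 * (4 ^ k.+1 * b))%N by rewrite cB mulnA -expnS.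
have [all|[A' [B' [A'A B'B cA' cB' le]]]] := step _ A B _ d0 cle u0 cA4 cB4 dAB.
  exists (4 ^ k.+1 * b)%N, A, B; split; rewrite ?leqnn ?andbT ?cA ?cB ?mulnA -?expnS //.
  by rewrite leq_pmull // expn_gt0.
have cle' : c <= (30 / 31) ^+ k / 64.
  apply: (le_trans cle); rewrite ler_pM2r ?invr_gt0 ?ltr0n // exprS ler_piMl //; last lra.
  by rewrite exprn_ge0 // divr_ge0 ?ler0n.
have [|u [A2 [B2 [/andP[bu ub] [A2A' B2B'] cA2 cB2 all]]]] := IH cle' A' B' b b0 cA' cB'.
  by rewrite cA' cB'; apply: le_trans le; rewrite exprS; lra.
exists u, A2, B2; split=> //; last first.
  by split; [exact: subset_trans A'A|exact: subset_trans B'B].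
by rewrite bu (leq_trans ub) // leq_mul2r leq_exp2l // leqnSn orbT.
Qed.

End Density.

Definition adj (T : finType) (E : {set {set T}}) : rel T := fun x y => [set x; y] \in E.

Lemma card_edges_le_links (T : finType) (E : {set {set T}}) : E \subset pairs T ->
  (#|E| <= links (adj E) setT setT)%N.
Proof.
move=> E2; rewrite /links pair_big /= (eq_bigl (mem [set: T * T])) => [|z]; last first.
  by rewrite !inE.
rewrite -card_set_sum.
apply: leq_trans (leq_imset_card (fun z : T * T => [set z.1; z.2]) _).
apply/subset_leq_card/subsetP => e eE.
have := subsetP E2 e eE; rewrite inE => /cards2P[x [y [_ eE']]].
by apply/imsetP; exists (x, y); rewrite // !inE /adj -eE'.
Qed.

(** [A] is a set of [a] vertices with at least its share of links. Since [a <= eps / 2 * n], at most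
    half of the guaranteed number lie inside [A], so [A] has density at least [eps / 2] to its
    complement, which is then trimmed to size [a]. The density increments start from this balanced
    pair. *)
Lemma graph_dense_pair (R : realFieldType) (T : finType) (E : {set {set T}})
    (eps c : R) (K b : nat) :
  E \subset pairs T -> (0 < b)%N -> c <= (30 / 31) ^+ K / 64 ->
  (30 / 31) ^+ K <= eps / 2 -> (4 ^ K.+1 * b)%:R <= eps / 2 * #|T|%:R ->
  (4 ^ K.+2 * b <= #|T|)%N -> eps * #|T|%:R ^+ 2 <= #|E|%:R ->
  exists u (R1 R2 : {set T}), [/\ (b <= u)%N, (16 * u <= #|T|)%N, [disjoint R1 & R2],
    #|R1| = (4 * u)%N /\ #|R2| = (4 * u)%N &
    forall A1 B1 : {set T}, A1 \subset R1 -> B1 \subset R2 -> (u <= #|A1|)%N -> (u <= #|B1|)%N ->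
      c * (u ^ 2)%:R <= (links (adj E) A1 B1)%:R].
Proof.
move=> E2 b0 cK Keps beps bT ET; set a := (4 ^ K.+1 * b)%N in beps.
set n := #|T| in beps bT ET *.
have a4 : (4 * a <= n)%N by rewrite /a mulnA -expnS.
have a_gt0 : (0 < a)%N by rewrite muln_gt0 expn_gt0.
have a0 : 0 < a%:R :> R by rewrite ltr0n.
have n0 : 0 < n%:R :> R by rewrite ltr0n (leq_trans _ a4) // muln_gt0.
have aT : (a <= #|[set: T]|)%N by rewrite cardsT; apply: leq_trans a4; rewrite leq_pmull.
have [A /andP[_ /eqP Aa] leA] :=
  dense_subset (fun x => \sum_(y in [set: T]) adj E x y)%N aT.
rewrite -!/(links (adj E) _ _) cardsT -/n in leA.
have linksA : eps * n%:R * a%:R <= (links (adj E) A setT)%:R.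
  rewrite -(ler_pM2r n0); apply: le_trans (_ : #|E|%:R * a%:R <= _).
    by rewrite mulrAC ler_pM2r // -mulrA -expr2.
  rewrite -!natrM ler_nat; apply: leq_trans leA.
  by rewrite leq_mul2r card_edges_le_links ?orbT.
have linksAC : eps / 2 * n%:R * a%:R <= (links (adj E) A (~: A))%:R.
  have := links_split (adj E) (subxx A) (subsetT A).
  rewrite setDv [links _ set0 _]/links big_set0 addn0 setTD => lE.
  have := links_le (adj E) A A; rewrite Aa -(ler_nat R) natrM => lAA.
  have : a%:R * a%:R <= eps / 2 * n%:R * a%:R by rewrite ler_pM2r.
  move: linksA; rewrite lE natrD; lra.
have aC : (a <= #|~: A|)%N.
  by rewrite cardsCs setCK Aa -/n leq_subRL; move: a4; clear; lia.
have [A' [B [A'A BA cA' cB le]]] := dense_subpair (adj E) (eq_leq (esym Aa)) aC.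
have A'E : A' = A by apply/eqP; rewrite eqEcard A'A Aa cA' leqnn.
subst A'; rewrite Aa in le.
have AC0 : 0 < #|~: A|%:R :> R by rewrite ltr0n (leq_trans a_gt0).
have ACn : #|~: A|%:R <= n%:R :> R by rewrite ler_nat max_card.
have dense : (30 / 31) ^+ K * (#|A| * #|B|)%:R <= (links (adj E) A B)%:R :> R.
  rewrite Aa cB natrM.
  apply: le_trans (_ : eps / 2 * (a%:R * a%:R) <= _).
    by rewrite ler_pM2r ?mulr_gt0.
  have eps0 : 0 < eps / 2 by apply: lt_le_trans Keps; rewrite exprn_gt0 // divr_gt0 ?ltr0n.
  rewrite -(ler_pM2r (mulr_gt0 a0 AC0)).
  apply: le_trans (_ : (eps / 2 * n%:R * a%:R) * (a%:R * a%:R) <= _).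
    rewrite [leLHS](_ : _ = eps / 2 * a%:R ^+ 3 * #|~: A|%:R); last by ring.
    rewrite [leRHS](_ : _ = eps / 2 * a%:R ^+ 3 * n%:R); last by ring.
    by rewrite ler_pM2l // mulr_gt0 // exprn_gt0.
  apply: le_trans (_ : (links (adj E) A (~: A))%:R * (a%:R * a%:R) <= _).
    by rewrite ler_pM2r ?mulr_gt0.
  by rewrite -!natrM ler_nat.
have [u [A2 [B2 [/andP[bu ub] [A2A B2B] cA2 cB2 all]]]] := dense_pair_exists cK b0 Aa cB dense.
exists u, A2, B2; split => //.
- by move: a4 ub; rewrite /a expnS; clear; set z := (4 ^ K * b)%N; lia.
- rewrite disjoints_subset; apply: subset_trans A2A _.
  by rewrite -disjoints_subset disjoint_sym disjoints_subset (subset_trans B2B).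
Qed.

(** * Completing a partial embedding *)

Section Completion.
Variables (T : finType) (t : nat) (x y : 'I_t -> T) (Z : {set T}) (g : T -> T).
Variables (R1 R2 : {set T}) (Q : {set T * T}) (c B : nat).
Hypotheses (x_inj : injective x) (y_inj : injective y) (xy : forall i j, x i != y j).
Hypotheses (xZ : forall j, x j \notin Z) (yZ : forall j, y j \notin Z).
Hypotheses (g_inj : {in Z &, injective g}) (R12 : [disjoint R1 & R2]).
Hypothesis gR : forall z, z \in Z -> (g z \notin R1) && (g z \notin R2).
Hypothesis QR : forall q, q \in Q -> (q.1 \in R1) && (q.2 \in R2).
Hypothesis Qc : forall U1 U2 : {set T}, (#|U1| < t)%N -> (#|U2| < t)%N ->
  (c <= #|[set q in Q | (q.1 \notin U1) && (q.2 \notin U2)]|)%N.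
Let X := [set x j | j : 'I_t] :|: [set y j | j : 'I_t].
Let free := ~: (Z :|: X).
Hypotheses (B0 : (0 < B)%N) (Tfree : (#|T| <= B * #|free|)%N) (Tc : (#|T| ^ 2 <= B * c)%N).

Definition base_for (sg : {ffun 'I_t -> T * T}) (s : {perm T}) : bool :=
  [forall z in Z, s z == g z] &&
  [forall j, (s (x j) == (sg j).1) && (s (y j) == (sg j).2)].

(** Any extension to the free vertices will do, since [completion] permutes them at random
    beforehand. The default is not reached for [sg] in [pair_seqs t Q]. *)
Definition base (sg : {ffun 'I_t -> T * T}) : {perm T} :=
  odflt 1%g [pick s | base_for sg s].

Lemma baseP sg : sg \in pair_seqs t Q ->
  {in Z, base sg =1 g} /\ forall j, base sg (x j) = (sg j).1 /\ base sg (y j) = (sg j).2.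
Proof.
rewrite inE => /and3P[/forallP sQ /injectiveP s1 /injectiveP s2].
pose f z := if [pick j | x j == z] is Some j then (sg j).1 else
  if [pick j | y j == z] is Some j then (sg j).2 else g z.
have fx j : f (x j) = (sg j).1.
  by rewrite /f; case: pickP => [i /eqP/x_inj -> //|/(_ j)]; rewrite eqxx.
have fy j : f (y j) = (sg j).2.
  rewrite /f; case: pickP => [i|_]; first by rewrite (negbTE (xy i j)).
  by case: pickP => [i /eqP/y_inj -> //|/(_ j)]; rewrite eqxx.
have fZ z : z \in Z -> f z = g z.
  move=> zZ; rewrite /f; case: pickP => [i /eqP xz|_].
    by have := xZ i; rewrite xz zZ.
  by case: pickP => [i /eqP yz|//]; have := yZ i; rewrite yz zZ.
have sR j : ((sg j).1 \in R1) && ((sg j).2 \in R2) by apply: QR.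
(* [Z] goes outside [R1] and [R2], the [x j] into [R1], the [y j] into [R2]: a collision can only
   occur within one of the three kinds. *)
have f_inj : {in Z :|: X &, injective f}.
  have kind z : z \in Z :|: X -> [\/ z \in Z, exists j, z = x j | exists j, z = y j].
    case/setUP => [zZ|/setUP[] /imsetP[j _ ->]]; first by apply: Or31.
      by apply: Or32; exists j.
    by apply: Or33; exists j.
  move=> z z' /kind[zZ|[j ->]|[j ->]] /kind[z'Z|[j' ->]|[j' ->]];
    rewrite ?fx ?fy ?fZ // => E.
  - exact: g_inj.
  - by have := gR zZ; rewrite E; case/andP: (sR j') => ->.
  - by have := gR zZ; rewrite E; case/andP: (sR j') => _ ->; rewrite andbF.
  - by have := gR z'Z; rewrite -E; case/andP: (sR j) => ->.
  - by rewrite (s1 _ _ E).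
  - by case/andP: (sR j); rewrite E => /(disjointFr R12); case/andP: (sR j') => _ ->.
  - by have := gR z'Z; rewrite -E; case/andP: (sR j) => _ ->; rewrite andbF.
  - by case/andP: (sR j') => /(disjointFr R12); rewrite -E; case/andP: (sR j) => _ ->.
  - by rewrite (s2 _ _ E).
have [s sf] := perm_extend f_inj.
have ok : base_for sg s.
  apply/andP; split.
    by apply/forall_inP => z zZ; rewrite sf ?fZ // inE zZ.
  apply/forallP => j; rewrite !sf ?fx ?fy ?eqxx // !inE imset_f ?orbT //.
rewrite /base; case: pickP => [s' /andP[/forall_inP sZ /forallP sX]|/(_ s)]; last first.
  by rewrite ok.
split=> [z zZ|j]; first exact/eqP/sZ.
by case/andP: (sX j) => /eqP-> /eqP->.
Qed.

Definition completion (i : {ffun 'I_t -> T * T} * {perm T}) (v : T) : T := base i.1 (i.2 v).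

Definition completions : {set {ffun 'I_t -> T * T} * {perm T}} :=
  setX (pair_seqs t Q) [set s : {perm T} | perm_on free s].

Lemma completion_inj i : injective (completion i).
Proof. by move=> u v /perm_inj/perm_inj. Qed.

Lemma completion_fixed i v : i \in completions -> v \notin free -> completion i v = base i.1 v.
Proof.
by case: i => sg s; rewrite inE => /andP[_]; rewrite inE /completion /= => sf /(out_perm sf) ->.
Qed.

(** Each [h w] is some [x j] or [y j], which [k] and [b] decode. At most [#|D|] entries are
    concerned, and each costs [#|T| ^ 2 / c], at most [B]. *)
Lemma base_point_spread (D : {set T}) (h : T -> T) :
  (forall w, w \in D -> h w \in X) ->
  (#|[set sg in pair_seqs t Q | [forall w in D, base sg (h w) == w]]| * #|T| ^ #|D|
     <= B ^ #|D| * #|pair_seqs t Q|)%N.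
Proof.
move=> hX; have [->|[w0 w0D]] := set_0Vmem D.
  rewrite cards0 !expn0 muln1 mul1n; apply/subset_leq_card/subsetP => sg.
  by rewrite inE => /andP[].
have [j0 _] : exists j : 'I_t, true.
  by have := hX w0 w0D; rewrite !inE => /orP[] /imsetP[j _ _]; exists j.
pose k w := odflt j0 [pick j | (x j == h w) || (y j == h w)].
pose b w := x (k w) == h w.
have kb w : w \in D -> h w = if b w then x (k w) else y (k w).
  move=> /hX; rewrite /b /k; case: pickP => [j|noj] /=.
    by case: eqP => //= _ /eqP.
  by rewrite !inE => /orP[] /imsetP[j _ E]; have := noj j; rewrite E eqxx ?orbT.
have := pair_seqs_point_spread Qc D k b.
set PS := [set sg in _ | _]; set PS' := [set sg in _ | _].
have -> : PS = PS'.
  apply/setP => sg; rewrite !inE; apply: andb_id2l => sgQ.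
  apply: eq_forallb => w; case: (boolP (w \in D)) => //= wD.
  have sgP : sg \in pair_seqs t Q by rewrite inE.
  have [_ sX] := baseP sgP; have [sx sy] := sX (k w).
  by rewrite kb //; case: (b w); rewrite ?sx ?sy eq_sym.
have T0 : (0 < #|T|)%N by apply/card_gt0P; exists w0.
have c0 : (0 < c)%N.
  by rewrite lt0n; apply/eqP => c0; move: Tc; rewrite c0 muln0 leqn0 expn_eq0 eqn0Ngt T0.
have kD : (#|k @: D| <= #|D|)%N by apply: leq_imset_card.
move=> le; have ck0 : (0 < c ^ #|k @: D|)%N by rewrite expn_gt0 c0.
rewrite -(leq_pmul2l ck0) mulnCA mulnA; apply: (leq_trans le).
rewrite mulnA expnM leq_mul2r; apply/orP; right.
apply: leq_trans (leq_exp_base _ Tc) _; rewrite expnMn mulnC leq_mul2l; apply/orP; right.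
by rewrite leq_pexp2l.
Qed.

(** Two independent sources of randomness: [sg] places the vertices of [X] and [s] the free ones.
    Those of [Z] have a fixed place and are left out. *)
Lemma completion_point_spread (D : {set T}) (h : T -> T) :
  (forall w, w \in D -> h w \in ~: Z) ->
  (#|[set i in completions | [forall w in D, completion i (h w) == w]]| * #|T| ^ #|D|
     <= (16 * B) ^ #|D| * #|completions|)%N.
Proof.
move=> hZ; pose D1 := [set w in D | h w \in X]; pose D2 := D :\: D1.
have D1D : D1 \subset D by apply/subsetP => w; rewrite inE => /andP[].
have DE : #|D| = (#|D1| + #|D2|)%N by rewrite -(cardsID D1 D) (setIidPr D1D).
have D1X w : w \in D1 -> h w \in X by rewrite inE => /andP[].
have D2f w : w \in D2 -> h w \in free.
  rewrite !inE => /andP[+ wD]; rewrite wD /= => hX.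
  by have := hZ w wD; rewrite inE => hZw; rewrite !negb_or hZw -negb_or.
pose S := [set sg in pair_seqs t Q | [forall w in D1, base sg (h w) == w]].
(* Given [sg], a free vertex lands on [w] exactly when [s] sends it to the preimage of [w] under
   [base sg]. *)
pose P sg := [set s : {perm T} | perm_on free s && [forall w in D2, s (h w) == (base sg)^-1%g w]].
have le1 : (#|[set i in completions | [forall w in D, completion i (h w) == w]]|
    <= \sum_(sg in S) #|P sg|)%N.
  rewrite -sum1_card (partition_big (fun i => i.1) (mem S)) /= => [|i]; last first.
    rewrite inE => /andP[iC /forall_inP iD].
    have := iC; rewrite !inE => /andP[-> _] /=; apply/forall_inP => w wD1.
    have wD := subsetP D1D w wD1; rewrite -completion_fixed ?iD //.
    by rewrite inE negbK; apply/setUP; right; apply: D1X.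
  apply: leq_sum => sg sgS; rewrite sum1_card.
  apply: leq_trans (_ : #|[set (sg, s) | s in P sg]| <= _)%N; last exact: leq_imset_card.
  apply/subset_leq_card/subsetP => -[sg' s]; rewrite unfold_in /= => /andP[+ /eqP E].
  rewrite E inE => /andP[sC /forall_inP sD]; apply: imset_f; rewrite inE.
  have := sC; rewrite !inE => /andP[_ ->] /=; apply/forall_inP => w wD2.
  have wD : w \in D by move: wD2; rewrite inE => /andP[].
  by rewrite -(inj_eq (@perm_inj _ (base sg))) permKV; apply: sD.
have le2 sg : (#|P sg| * #|free| ^ #|D2| <= 16 ^ #|D2| * #|free|`!)%N.
  by apply: perm_point_spread => //; apply: in2W; apply: perm_inj.
rewrite {2}/completions cardsX card_perm_on.
apply: leq_trans (leq_mul le1 (leqnn _)) _.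
have -> : (#|T| ^ #|D| = #|T| ^ #|D2| * #|T| ^ #|D1|)%N by rewrite -expnD addnC DE.
rewrite mulnA; apply: leq_trans (_ : (#|S| * ((16 * B) ^ #|D2| * #|free|`!)) * #|T| ^ #|D1| <= _)%N.
  rewrite leq_mul2r; apply/orP; right; rewrite big_distrl /= -sum_nat_const; apply: leq_sum => sg _.
  apply: leq_trans (leq_mul (leqnn _) (leq_exp_base _ Tfree)) _.
  by rewrite !expnMn mulnCA -mulnA [leqRHS]mulnCA leq_mul2l le2 orbT.
rewrite mulnAC; apply: leq_trans (leq_mul (base_point_spread D1X) (leqnn _)) _.
have B16 : (B ^ #|D1| <= (16 * B) ^ #|D1|)%N by rewrite leq_exp_base // leq_pmull.
apply: leq_trans (leq_mul (leq_mul B16 (leqnn _)) (leqnn _)) _.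
by rewrite mulnACA DE expnD.
Qed.

End Completion.

(** * The second phase *)

Lemma pair_seqs_neq0 (T : finType) (t c : nat) (Q : {set T * T}) : (0 < c)%N ->
  (forall U1 U2 : {set T}, (#|U1| < t)%N -> (#|U2| < t)%N ->
    (c <= #|[set q in Q | (q.1 \notin U1) && (q.2 \notin U2)]|)%N) ->
  (0 < #|pair_seqs t Q|)%N.
Proof.
move=> c0 Qc.
have ex k : (k <= t)%N -> exists s : seq (T * T),
    [/\ size s = k, all (mem Q) s, uniq (map fst s) & uniq (map snd s)].
  elim: k => [_|k IH kt]; first by exists [::].
  have [s [sk sQ s1 s2]] := IH (ltnW kt).
  have card_lt (f : T * T -> T) : (#|[set z in map f s]| < t)%N.
    by apply: leq_ltn_trans kt; rewrite cardsE (leq_trans (card_size _)) // size_map sk.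
  have := leq_trans c0 (Qc _ _ (card_lt fst) (card_lt snd)).
  case/card_gt0P => q; rewrite !inE => /and3P[qQ q1 q2].
  by exists (q :: s); rewrite /= sk qQ sQ q1 q2.
have [s [sk /allP sQ s1 s2]] := ex t (leqnn t).
case: (posnP t) => [t0|t0].
  have no (j : 'I_t) : False by case: j => j; rewrite t0.
  apply/card_gt0P; exists [ffun j => False_rect _ (no j)]; rewrite inE.
  by apply/and3P; split; [apply/forallP=> j|apply/injectiveP=> j|apply/injectiveP=> j];
    case: (no j).
case: s sk sQ s1 s2 => [t0'|q0 s]; first by rewrite -t0' in t0.
set s' := q0 :: s => sk sQ s1 s2.
apply/card_gt0P; exists [ffun j : 'I_t => nth q0 s' j]; rewrite inE; apply/and3P; split.
- by apply/forallP => j; rewrite ffunE; apply: sQ; rewrite mem_nth // sk.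
- apply/injectiveP => i j; rewrite !ffunE -!(nth_map _ q0.1 fst) ?sk // => /eqP.
  by rewrite nth_uniq ?size_map ?sk // => /eqP/val_inj.
- apply/injectiveP => i j; rewrite !ffunE -!(nth_map _ q0.2 snd) ?sk // => /eqP.
  by rewrite nth_uniq ?size_map ?sk // => /eqP/val_inj.
Qed.

Lemma card_cover_uniform (T : finType) (P : {set {set T}}) r :
  trivIset P -> (forall C, C \in P -> #|C| = r) -> #|cover P| = (#|P| * r)%N.
Proof.
move=> /eqP <- Pr; rewrite -sum_nat_const; apply: eq_bigr => C; exact: Pr.
Qed.

Lemma linksE_card (T : finType) (q : rel T) (A B : {set T}) :
  links q A B = #|[set z : T * T | [&& z.1 \in A, z.2 \in B & q z.1 z.2]]|.
Proof.
rewrite /links pair_big /= -sum1_card [RHS]big_mkcond [LHS]big_mkcond /=.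
apply: eq_bigr => z _; rewrite inE.
by case: (z.1 \in A); case: (z.2 \in B); case: (q _ _).
Qed.

(** [m] counts the clique components, [b] the placed vertices and [a] the free ones. If
    [m <= 3 * u], nothing is tiled and at most two thirds of the vertices are pinned. Otherwise each
    of the [3 * u] untiled cliques keeps at least one of its [r] vertices free. *)
Lemma free_vertices_bound (m n r u x a b : nat) : (2 < r)%N -> (m * r <= n)%N ->
  (16 * u <= n)%N -> (x <= 2 * minn m (3 * u))%N -> (b <= (m - 3 * u) * r + x)%N ->
  (b + a = n)%N -> (u <= a)%N.
Proof.
move=> r3 mr un xm bx ban.
have [le|lt] := leqP m (3 * u)%N.
  have m3 : (m * 3 <= m * r)%N by rewrite leq_mul2l r3 orbT.
  move: bx xm; rewrite (minn_idPl le) (_ : m - 3 * u = 0)%N ?mul0n; last by apply/eqP.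
  by clear -m3 mr un ban; move: (m * r)%N m3 mr => k; lia.
have u3 : (3 * u * 3 <= 3 * u * r)%N by rewrite leq_mul2l r3 orbT.
have ur : (3 * u * r <= m * r)%N by rewrite leq_mul2r (ltnW lt) orbT.
move: bx xm; rewrite mulnBl (minn_idPr (ltnW lt)).
by clear -u3 ur mr ban; move: (m * r)%N (3 * u * r)%N u3 ur mr => k l; lia.
Qed.

Section SecondPhase.
Variables (R : realFieldType) (T : finType) (F E W1 : {set {set T}}) (Delta u c B : nat).
Variables (R1 R2 : {set T}) (y : R).
Let r := Delta.+1.
Let M := (r * (r ^ 2 - 1))%N.
Let K : R := Delta%:R * (16 * B)%:R ^+ 2.
Let mu : R := K ^+ (r ^ 2) * y.
Let p : R := y ^+ (2 * (r ^ 2 - 1)).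
Hypotheses (F2 : F \subset pairs T) (Delta1 : (1 < Delta)%N).
Hypothesis deg : forall v, (#|[set e in F | v \in e]| <= Delta)%N.
Hypotheses (u0 : (0 < u)%N) (c0 : (0 < c)%N) (uT : (16 * u <= #|T|)%N) (R12 : [disjoint R1 & R2]).
Hypotheses (cR1 : #|R1| = (4 * u)%N) (cR2 : #|R2| = (4 * u)%N).
Hypothesis dense : forall A1 B1 : {set T}, A1 \subset R1 -> B1 \subset R2 ->
  (u <= #|A1|)%N -> (u <= #|B1|)%N -> (c <= links (adj E) A1 B1)%N.
Hypotheses (Bu : (#|T| <= B * u)%N) (Bc : (#|T| ^ 2 <= B * c)%N).
Hypothesis cliquesW1 : has_cliques (~: (R1 :|: R2)) r (#|cliques F r| - 3 * u) W1.
Hypotheses (y0 : 0 < y) (y1 : y <= 1) (ny : #|T|%:R * y ^+ M = 1) (Ky : K * y <= 1).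
Hypotheses (mu8 : mu <= 1 / 8) (small : Delta%:R * #|T|%:R * mu ^+ M.+1 < 1).

(** [mu] makes the spread [(K * y) ^+ (2 * r ^ 2)] of the clique-free rest equal to [p * mu ^+ 2].
    [W1] is fixed; only the placement and [W2] are random. *)
Lemma Ex_second_phase :
  1 - 16 * mu * 2 ^+ M.+1 <= Ex (pairs T) (rounds p M.+1)
    (fun W2 => [exists f : {perm T}, img_edges f F \subset E :|: W1 :|: W2]%:R).
Proof.
pose cF := cliques F r.
have T0 : (0 < #|T|)%N by apply: leq_trans uT; rewrite muln_gt0.
have [v0 _] := card_gt0P T0.
have cFr C : C \in cF -> #|C| = r by rewrite inE => /andP[/eqP].
have cFt : trivIset cF := trivIset_cliques F2 deg.
(* At most [3 * u] cliques stay untiled: removing fewer than [3 * u] vertices from a side of size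
   [4 * u] leaves at least [u], the size from which density is guaranteed. *)
have [P1 P1F P1c] := @subset_card_exists _ cF (minn #|cF| (3 * u)) (geq_minl _ _).
have P1r C : C \in P1 -> #|C| = r by move=> /(subsetP P1F)/cFr.
pose P2 := cF :\: P1; have P2F : P2 \subset cF by apply: subsetDl.
have P2r C : C \in P2 -> #|C| = r by move=> /(subsetP P2F)/cFr.
have P2c : #|P2| = (#|cF| - 3 * u)%N.
  by rewrite cardsD (setIidPr P1F) P1c; move: #|cF| => m; clear; lia.
have [Qf /and3P[Qt Qc /forall_inP QfP]] := existsP cliquesW1.
have Qr C : C \in Qf -> #|C| = r by move=> /QfP/andP[_]; rewrite inE => /andP[/eqP].
have P2t : trivIset P2 by apply: trivIsetS cFt.
have [|g [g_inj gP2]] := trivIset_map P2t Qt _ P2r Qr; first by rewrite P2c.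
pose Z := cover P2; pose t := #|P1|.
have t3u : (t <= 3 * u)%N by rewrite /t P1c geq_minr.
pose C (j : 'I_t) := enum_val j.
have CP1 j : C j \in P1 by apply: enum_valP.
have CF j : C j \in cF by apply: (subsetP P1F).
pose x j := nth v0 (enum (C j)) 0; pose x' j := nth v0 (enum (C j)) 1.
have Csz j : (1 < size (enum (C j)))%N by rewrite -cardE P1r // ltnS ltnW.
have xC j : x j \in C j by rewrite -mem_enum mem_nth // ltnW.
have x'C j : x' j \in C j by rewrite -mem_enum mem_nth.
have xx' j : x j != x' j by rewrite nth_uniq ?enum_uniq // ltnW.
have Cdisj i j v : v \in C i -> v \in C j -> i = j.
  move=> vi vj; apply: enum_val_inj.
  by rewrite -[LHS](def_pblock cFt (CF i) vi) (def_pblock cFt (CF j) vj).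
have CZ j v : v \in C j -> v \notin Z.
  move=> vC; apply/negP => /bigcupP[C' C'P2 vC']; move: C'P2.
  rewrite inE => /andP[+ C'F].
  by rewrite -(def_pblock cFt C'F vC') (def_pblock cFt (CF j) vC) CP1.
have x_inj : injective x by move=> i j ij; apply: Cdisj (xC i) _; rewrite ij.
have x'_inj : injective x' by move=> i j ij; apply: Cdisj (x'C i) _; rewrite ij.
have xx'_neq i j : x i != x' j.
  by apply/negP => /eqP ij; have iE := Cdisj i j _ (xC i); rewrite ij in iE;
    move: ij; rewrite (iE (x'C j)) => /eqP; rewrite (negbTE (xx' j)).
have gR z : z \in Z -> (g z \notin R1) && (g z \notin R2).
  move=> /bigcupP[C' C'P2 zC']; have [C2 /QfP/andP[C2R _] gC2] := gP2 C' C'P2.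
  by have := subsetP C2R _ (gC2 z zC'); rewrite !inE negb_or.
pose Q := [set q : T * T | [&& q.1 \in R1, q.2 \in R2 & adj E q.1 q.2]].
have QR q : q \in Q -> (q.1 \in R1) && (q.2 \in R2) by rewrite inE => /and3P[-> ->].
have big (A U : {set T}) : #|A| = (4 * u)%N -> (#|U| < t)%N -> (u <= #|A :\: U|)%N.
  move=> cA Ut; have := cardsD A U; have := subset_leq_card (subsetIr A U).
  rewrite cA; move: t3u Ut; clear; lia.
have Qcount (U1 U2 : {set T}) : (#|U1| < t)%N -> (#|U2| < t)%N ->
    (c <= #|[set q in Q | (q.1 \notin U1) && (q.2 \notin U2)]|)%N.
  move=> U1t U2t; apply: leq_trans (dense (subsetDl R1 U1) (subsetDl R2 U2) _ _) _.
  - exact: big.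
  - exact: big.
  rewrite linksE_card; apply/subset_leq_card/subsetP => q; rewrite !inE.
  by case/and3P=> /andP[-> ->] /andP[-> ->] ->.
pose X := [set x j | j : 'I_t] :|: [set x' j | j : 'I_t].
have Tfree : (#|T| <= B * #|~: (Z :|: X)|)%N.
  apply: leq_trans Bu _; rewrite leq_mul2l; apply/orP; right.
  have cX : (#|X| <= 2 * t)%N.
    apply: leq_trans (leq_card_setU _ _) _; rewrite mul2n -addnn leq_add //;
      by apply: leq_trans (leq_imset_card _ _) _; rewrite card_ord.
  have cZ : #|Z| = ((#|cF| - 3 * u) * r)%N by rewrite (card_cover_uniform P2t P2r) P2c.
  have cT : (#|cF| * r <= #|T|)%N by rewrite -(card_cover_uniform cFt cFr) max_card.
  have cC := cardsC (Z :|: X).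
  have cU : (#|Z :|: X| <= #|Z| + #|X|)%N by rewrite leq_card_setU.
  rewrite cZ in cU; rewrite /t P1c in cX.
  exact: (free_vertices_bound _ cT uT cX cU cC).
have B0 : (0 < B)%N by move: Bu; case: (B) => //; rewrite mul0n leqNgt T0.
(* What is left for [W2]: edges meeting [Z] are realised in [W1], and one edge of each clique in
   [P1] is realised in [E]. *)
pose F' := [set e in F | (e \subset ~: Z) && ~~ [exists j, e == [set x j; x' j]]].
have F'F : F' \subset F by apply/subsetP => e; rewrite inE => /andP[].
have F'2 := subset_trans F'F F2.
have F'Z e : e \in F' -> e \subset ~: Z by rewrite inE => /and3P[].
have F'deg v : (#|[set e in F' | v \in e]| <= Delta)%N.
  apply: leq_trans (deg v); apply/subset_leq_card/subsetP => e; rewrite !inE.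
  by case/andP=> /andP[-> _] ->.
(* A clique of [F'] would be one of [F]; those in [P1] have lost an edge and those in [P2] lie in
   [Z]. *)
have F'free : cliques F' Delta.+1 = set0.
  apply/setP => C0; rewrite [RHS]inE; apply/negP; rewrite inE => /andP[/eqP C0r C0cl].
  have C0F : C0 \in cF.
    rewrite inE C0r eqxx; apply/is_cliqueP => v w vC wC vw.
    by apply: (subsetP F'F); apply: (is_cliqueP _ _ C0cl).
  have [C0P1|C0P1] := boolP (C0 \in P1).
    pose j : 'I_t := enum_rank_in C0P1 C0.
    have Cj : C j = C0 by rewrite /C enum_rankK_in.
    have : [set x j; x' j] \in F'.
      by apply: (is_cliqueP _ _ C0cl) => //; rewrite -Cj.
    by rewrite inE => /and3P[_ _ /existsP[]]; exists j.
  have C0P2 : C0 \in P2 by rewrite inE C0P1.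
  have [v [w [vC wC vw]]] : exists v w, [/\ v \in C0, w \in C0 & v != w].
    have v0C : (1 < #|C0|)%N by rewrite C0r ltnS ltnW.
    have [v vC] := card_gt0P (ltnW v0C).
    have : (0 < #|C0 :\ v|)%N by move: v0C; rewrite (cardsD1 v) vC.
    case/card_gt0P => w; rewrite !inE => /andP[wv wC].
    by exists v, w; rewrite eq_sym.
  have := F'Z _ (is_cliqueP _ _ C0cl v w vC wC vw).
  rewrite subUset sub1set inE => /andP[/negP[]].
  by apply/bigcupP; exists C0.
have sparse D : (2 * r ^ 2 * #|edges_in F' D| <= M * #|D|.-1)%N.
  rewrite /M -[leqRHS]mulnA (_ : 2 * r ^ 2 = r * (2 * r))%N; last by rewrite mulnCA mulnn.
  by rewrite -[leqLHS]mulnA leq_mul2l sparse_cliquefree ?orbT.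
pose J := completions x x' Z Q.
pose S i := img_edges (completion x x' Z g i) F'.
have xZ j : x j \notin Z by apply: CZ.
have x'Z j : x' j \notin Z by apply: CZ.
have point (D : {set T}) (h : {ffun T -> T}) : (forall w, w \in D -> h w \in ~: Z) ->
    #|[set i in J | [forall w in D, completion x x' Z g i (h w) == w]]|%:R
      * #|T|%:R ^+ #|D| <= (16 * B)%:R ^+ #|D| * #|J|%:R :> R.
  move=> hZ; rewrite -!natrX -!natrM ler_nat.
  exact: (completion_point_spread x_inj x'_inj xx'_neq xZ x'Z g_inj R12 gR QR Qcount).
have J0 : 0 < #|J|%:R :> R.
  rewrite ltr0n /J /completions cardsX card_perm_on muln_gt0 fact_gt0 andbT.
  exact: pair_seqs_neq0 c0 Qcount.
have B1 : 1 <= (16 * B)%:R :> R by rewrite ler1n muln_gt0.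
have K0 : 0 < K by rewrite mulr_gt0 ?exprn_gt0 ?ltr0n ?muln_gt0 // ltnW.
have mu0 : 0 < mu by rewrite mulr_gt0 // exprn_gt0.
have r1 : (1 < r ^ 2)%N by rewrite sqr_gt1 // ltnS ltnW.
have spread (X0 : {set {set T}}) : #|[set i in J | X0 \subset S i]|%:R
    <= ((K * y) ^+ (2 * r ^ 2)) ^+ #|X0| * #|J|%:R.
  apply: (@embedding_spread R T T _ F' (~: Z) Delta (2 * r ^ 2) M J
    (completion x x' Z g) #|T|%:R (16 * B)%:R y) => //.
  - by move=> i _; apply: completion_inj.
  - exact: ltnW.
  - by rewrite /M muln_gt0 /= subn_gt0.
have p01 : 0 < p <= 1 by rewrite exprn_gt0 //= exprn_ile1 // ltW.
have L0 : 0 <= Delta%:R * #|T|%:R :> R by rewrite -natrM.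
have mu08 : 0 <= mu <= 1 / 8 by rewrite ltW.
have q0 : 0 <= (K * y) ^+ (2 * r ^ 2) by rewrite exprn_ge0 // mulr_ge0 // ltW.
have qp : (K * y) ^+ (2 * r ^ 2) <= p * mu ^+ 2.
  have -> : mu ^+ 2 = K ^+ (2 * r ^ 2) * y ^+ 2 by rewrite exprMn -exprM mulnC.
  rewrite [leLHS]exprMn mulrCA -exprD.
  by rewrite (_ : 2 * (r ^ 2 - 1) + 2 = 2 * r ^ 2)%N // mulnBr subnK // leq_mul2l ltnW.
have SE i : i \in J -> S i \subset pairs T.
  by move=> _; apply: img_edges_pairs F'2; apply: completion_inj.
have SL i : i \in J -> #|S i|%:R <= Delta%:R * #|T|%:R :> R.
  move=> _; rewrite -natrM ler_nat (leq_trans (card_img_edges _ _)) //.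
  have := handshake F'2 F'deg setT; rewrite /edges_in cardsT.
  rewrite (_ : [set e in F' | _] = F').
    by apply: leq_trans; rewrite leq_pmull.
  by apply/setP => e; rewrite [LHS]inE subsetT andbT.
have J1 : 1 * #|J|%:R <= #|J|%:R :> R by rewrite mul1r.
have := Ex_rounds_contains p01 J0 L0 mu08 q0 qp small ltr01 SE SL spread J1.
rewrite invr1 mulr1 => main.
apply: le_trans (_ : 1 - 16 * mu * (2 ^+ M.+1 - 1) <= _).
  have mu16 : 0 < 16 * mu by apply: mulr_gt0.
  rewrite lerD2l lerN2 ler_pM2l //.
  by rewrite lerBlDr lerDl.
apply: (le_trans main); apply: le_Ex => [|W2 _].
  by apply: rounds01; case/andP: p01 => /ltW -> ->.
rewrite ler_nat; case: (boolP [exists i in J, _]) => // /exists_inP[[sg s] iJ SW2].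
have sgQ : sg \in pair_seqs t Q by move: iJ; rewrite inE => /andP[].
have [baseZ baseX] := baseP x_inj x'_inj xx'_neq xZ x'Z g_inj R12 gR QR sgQ.
pose f := (s * base x x' Z g sg)%g.
have fE v : f v = completion x x' Z g (sg, s) v by rewrite permM.
have fixed v : v \in Z :|: X -> f v = base x x' Z g sg v.
  by move=> vZX; rewrite fE (completion_fixed _ iJ) // inE negbK.
suff -> : [exists f : {perm T}, img_edges f F \subset E :|: W1 :|: W2] by [].
apply/existsP; exists f; apply/subsetP => _ /imsetP[e eF ->].
(* An edge meeting [Z] lies in a tiled clique and maps into [W1]; a pinned edge maps into [E]; any
   other is in [F'] and maps into [W2]. *)
have [eZ|] := boolP (e \subset ~: Z); last first.
  case/subsetPn => v ve; rewrite inE negbK => vZ.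
  have /bigcupP[C0 C0P2 vC0] := vZ.
  have [C1 /QfP/andP[_ C1W] gC1] := gP2 C0 C0P2.
  have eC0 := edge_clique F2 deg (subsetP P2F _ C0P2) eF ve vC0.
  have [w wv eE] := nbrsP F2 eF ve.
  have wC0 : w \in C0 by apply: (subsetP eC0); rewrite eE !inE eqxx orbT.
  have wZ : w \in Z by apply/bigcupP; exists C0.
  have fg z : z \in Z -> f z = g z.
    by move=> zZ; rewrite fixed ?baseZ // inE zZ.
  rewrite eE imsetU !imset_set1 !fg // !inE.
  move: C1W; rewrite inE => /andP[_ /is_cliqueP C1cl].
  rewrite C1cl ?orbT ?gC1 //.
  by rewrite -!fg // (inj_eq perm_inj) eq_sym.
have [/existsP[j /eqP eE]|ne] := boolP [exists j, e == [set x j; x' j]].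
  have [bx bx'] := baseX j.
  rewrite eE imsetU !imset_set1 !fixed ?bx ?bx'; last 2 first.
  - by rewrite !inE imset_f ?orbT.
  - by rewrite !inE imset_f ?orbT.
  have : sg j \in Q by move: sgQ; rewrite inE => /and3P[/forallP].
  by rewrite inE => /and3P[_ _]; rewrite /adj !inE => ->.
rewrite !inE; apply/orP; right; apply: (subsetP SW2).
apply/imsetP; exists e; first by rewrite inE eF eZ ne.
by apply: eq_imset => v; rewrite fE.
Qed.
End SecondPhase.

(** * Randomly perturbed graphs *)

Lemma half_exp_le (R : realFieldType) (k : nat) : (1 / 2) ^+ k <= k.+1%:R^-1 :> R.
Proof.
rewrite expr_div_n expr1n div1r lef_pV2 ?posrE ?exprn_gt0 ?ltr0n //.
by rewrite -natrX ler_nat ltn_expl.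
Qed.

(** The [m - 3 * u] cliques to be tiled must fit among [k0] with linear slack. Leaving out [3 * u]
    cliques saves at least [9 * u] vertices because [r] is at least 3, more than the [8 * u] taken
    by [R1] and [R2]. If [m <= 3 * u], nothing has to be tiled. *)
Lemma tiling_count_bound (n u r k0 m : nat) : (2 < r)%N -> (6 <= u)%N -> (16 * u <= n)%N ->
  (m * r <= n)%N -> (n - 8 * u < (k0 + 1) * r)%N -> (4 * r <= n)%N ->
  (4 * r * (m - 3 * u) + n <= 4 * r * k0)%N \/ (6 * (m - 3 * u) + u <= 6 * k0)%N.
Proof.
move=> r3 u6 un mr k0r rn.
have [le|lt] := leqP m (3 * u)%N.
  left; rewrite (_ : m - 3 * u = 0)%N ?muln0; last by apply/eqP.
  by rewrite -mulnA; move: k0r; rewrite mulnDl mul1n [(k0 * r)%N]mulnC; clear -un rn; move: (r * k0)%N => z; lia.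
right; suff : (6 * m + u <= 6 * k0 + 18 * u)%N by clear -lt; lia.
have r0 : (0 < r)%N by rewrite (ltn_trans _ r3).
rewrite -(leq_pmul2r r0) [leqLHS](_ : _ = 6 * (m * r) + u * r)%N; last by ring.
rewrite [leqRHS](_ : _ = 6 * (k0 * r) + 18 * (u * r))%N; last by ring.
have u3 : (u * 3 <= u * r)%N by rewrite leq_mul2l r3 orbT.
have ru : (6 * r <= u * r)%N by rewrite leq_mul2r u6 orbT.
by move: k0r; rewrite mulnDl mul1n; clear -u3 ru mr un; move: (u * r)%N (m * r)%N (k0 * r)%N u3 ru mr => a b c; lia.
Qed.

Lemma perturbed_contains (R : realFieldType) (eps : R) (Delta K D : nat) :
  (1 < Delta)%N -> (30 / 31) ^+ K <= eps / 2 -> (4 ^ K.+2 <= D)%N ->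
  (4 ^ K.+1)%:R <= eps / 2 * D%:R ->
  let r := Delta.+1 in let M := (r * (r ^ 2 - 1))%N in
  exists c Cerr y0 : R, [/\ 0 < y0, 0 <= Cerr & 
    forall (T : finType) (F E : {set {set T}}) (p y : R),
    F \subset pairs T -> E \subset pairs T ->
    (forall v, (#|[set e in F | v \in e]| <= Delta)%N) ->
    eps * #|T|%:R ^+ 2 <= #|E|%:R ->
    0 < y <= y0 -> #|T|%:R * y ^+ M = 1 -> c * y ^+ (2 * (r ^ 2 - 1)) <= p <= 1 ->
    1 - Cerr * y <= Ex (pairs T) p
      (fun W => [exists f : {perm T}, img_edges f F \subset E :|: W]%:R)].
Proof.
move=> Delta1 Keps KD KepsD r M.
have D0 : (0 < D)%N by apply: leq_trans KD; rewrite expn_gt0.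
pose Cd := (64 * 31 ^ K)%N; have Cd0 : (0 < Cd)%N by rewrite muln_gt0 expn_gt0.
(* Serves both [n <= B * u] and [n ^ 2 <= B * c], as [n <= 2 * D * u] and [u ^ 2 <= Cd * c]
   below. *)
pose B := (4 * D ^ 2 * Cd)%N.
have B0 : (0 < B)%N by rewrite !muln_gt0 expn_gt0 D0.
pose K1 : R := Delta%:R * 32%:R ^+ 2; pose K2 : R := Delta%:R * (16 * B)%:R ^+ 2.
have Delta0 : 0 < Delta%:R :> R by rewrite ltr0n ltnW.
have K10 : 0 < K1 by rewrite mulr_gt0 // exprn_gt0.
have K20 : 0 < K2 by rewrite mulr_gt0 // exprn_gt0 // ltr0n muln_gt0.
(* Makes the [Delta * n * mu1] missing edges equal to [n / (12 * D * r)], which fits in the slack of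
   the tiling. *)
pose mu1 : R := (12 * D * r * Delta)%:R^-1.
have r3 : (2 < r)%N by [].
have N1 : (8 <= 12 * D * r * Delta)%N.
  apply: (@leq_trans (12 * D)%N); first by move: D0; clear; lia.
  by rewrite -[leqRHS]mulnA leq_pmulr // muln_gt0 /= ltnW.
have mu10 : 0 < mu1 by rewrite invr_gt0 ltr0n (leq_trans _ N1).
have mu18 : mu1 <= 1 / 8.
  by rewrite div1r lef_pV2 ?posrE ?ltr0n ?(leq_trans _ N1) // ler_nat.
pose c0 : R := K1 ^+ (2 * (r ^ 2 - 1)) / mu1 ^+ 2.
have c00 : 0 < c0 by rewrite divr_gt0 ?exprn_gt0.
(* Each demand that [y] be small reads [x * y <= 1]; [H] adds up all these [x]. *)
pose H : R := K1 + 8 * K2 ^+ (r ^ 2) + K2 + 2 * Delta%:R * K2 ^+ (r ^ 2 * M.+1)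
  + (6 * D + 4 * r)%:R + 1.
have t1 : 0 < 8 * K2 ^+ (r ^ 2) by rewrite mulr_gt0 // exprn_gt0.
have t2 : 0 < 2 * Delta%:R * K2 ^+ (r ^ 2 * M.+1) by rewrite !mulr_gt0 // exprn_gt0.
have t3 : 0 <= (6 * D + 4 * r)%:R :> R by [].
have H0 : 0 < H by rewrite /H; move: K10 K20 t1 t2 t3; clear; lra.
(* [c0] pays for the tiling and [M.+1] for the rounds, each of density [y ^+ (2 * (r ^ 2 - 1))]. *)
exists (c0 + M.+1%:R), (48 * (D * r)%:R + 16 * K2 ^+ (r ^ 2) * 2 ^+ M.+1), H^-1.
split; [by rewrite invr_gt0| |].
  by rewrite addr_ge0 // mulr_ge0 ?exprn_ge0 // mulr_ge0 // exprn_ge0 // ltW.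
move=> T F E p y F2 E2 deg Eeps /andP[y0 yH] ny /andP[cp p1].
have Hy : H * y <= 1 by rewrite mulrC -ler_pdivlMr // div1r.
have term (x : R) : x <= H -> x * y <= 1 by move=> xH; rewrite (le_trans _ Hy) // ler_pM2r.
have y1 : y <= 1 by rewrite -[leLHS]mul1r term // /H; move: K10 K20 t1 t2 t3; clear; lra.
have K1y : K1 * y <= 1 by rewrite term // /H; move: K10 K20 t1 t2 t3; clear; lra.
have K2y : K2 * y <= 1 by rewrite term // /H; move: K10 K20 t1 t2 t3; clear; lra.
have mu2y : K2 ^+ (r ^ 2) * y <= 1 / 8.
  have : 8 * K2 ^+ (r ^ 2) * y <= 1 by rewrite term // /H; move: K10 K20 t1 t2 t3; clear; lra.
  by rewrite -mulrA; move: (K2 ^+ (r ^ 2) * y) => z; clear; lra.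
have Ly : 2 * Delta%:R * K2 ^+ (r ^ 2 * M.+1) * y <= 1.
  by rewrite term // /H; move: K10 K20 t1 t2 t3; clear; lra.
have n0y : (6 * D + 4 * r)%:R * y <= 1.
  by rewrite term // /H; move: K10 K20 t1 t2 t3; clear; lra.
set n := #|T| in Eeps ny *.
have M0 : (0 < M)%N by rewrite muln_gt0 /= subn_gt0 sqr_gt1 // ltnW.
have yM : y ^+ M <= y by rewrite -[leRHS]expr1 ler_wiXn2l // ltW.
have nn0 : (6 * D + 4 * r <= n)%N.
  rewrite -(ler_nat R) -(ler_pM2r (exprn_gt0 M y0)) ny (le_trans _ n0y) //.
  by rewrite ler_wpM2l.
have n_gt0 : (0 < n)%N by apply: leq_trans nn0; rewrite addn_gt0 muln_gt0 D0.
pose b := (n %/ D)%N.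
have b6 : (6 <= b)%N by rewrite /b leq_divRL // (leq_trans _ nn0) // leq_addr.
have b0 : (0 < b)%N by apply: leq_trans b6.
have bD : (b * D <= n)%N by apply: leq_trunc_div.
have nbD : (n <= 2 * D * b)%N.
  have : (n < b.+1 * D)%N by apply: ltn_ceil.
  rewrite mulSn => /ltnW/leq_trans; apply; rewrite -mulnA mul2n -addnn mulnC leq_add2r.
  by rewrite leq_pmulr.
have cK : Cd%:R^-1 <= (30 / 31) ^+ K / 64 :> R.
  rewrite /Cd natrM natrX invfM mulrC; apply: ler_wpM2r; first by rewrite invr_ge0.
  by rewrite expr_div_n -[leLHS]mul1r ler_wpM2r ?invr_ge0 ?exprn_ge0 // exprn_ege1 // ler1n.
have beps : (4 ^ K.+1 * b)%:R <= eps / 2 * n%:R.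
  have e0 : 0 <= eps / 2 by apply: le_trans Keps; rewrite exprn_ge0 // divr_ge0.
  apply: le_trans (_ : eps / 2 * (b * D)%:R <= _); last by rewrite ler_wpM2l // ler_nat.
  by rewrite !natrM [b%:R * D%:R]mulrC mulrA ler_wpM2r.
have bT : (4 ^ K.+2 * b <= n)%N by rewrite (leq_trans _ bD) // mulnC leq_mul2l KD orbT.
have [u [R1 [R2 [bu un R12 [cR1 cR2] dense]]]] :=
  graph_dense_pair E2 b0 cK Keps beps bT Eeps.
have u6 : (6 <= u)%N by apply: leq_trans b6 bu.
have u0 : (0 < u)%N by apply: leq_trans u6.
(* The ceiling of [u ^ 2 / Cd]: link counts are integers. *)
pose c := ((u ^ 2).-1 %/ Cd).+1.
have cdense (A1 B1 : {set T}) : A1 \subset R1 -> B1 \subset R2 -> (u <= #|A1|)%N -> (u <= #|B1|)%N ->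
    (c <= links (adj E) A1 B1)%N.
  move=> A1R B1R uA uB; have := dense A1 B1 A1R B1R uA uB.
  rewrite mulrC ler_pdivrMr ?ltr0n // -natrM ler_nat => le.
  by rewrite /c ltn_divLR // prednK ?expn_gt0 ?u0.
have nu : (n <= 2 * D * u)%N by apply: leq_trans nbD _; rewrite leq_mul2l bu orbT.
have Bu : (n <= B * u)%N.
  apply: leq_trans nu _; rewrite leq_mul2r; apply/orP; right.
  rewrite /B (_ : 4 * D ^ 2 * Cd = 2 * D * (2 * D * Cd))%N ?leq_pmulr ?muln_gt0 ?D0 ?expn_gt0 //.
  by rewrite -mulnn; clear; lia.
have Bc : (n ^ 2 <= B * c)%N.
  apply: leq_trans (leq_exp_base 2 nu) _.
  rewrite expnMn /B expnMn -[leqRHS]mulnA leq_mul2l; apply/orP; right.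
  by rewrite mulnC -(prednK (_ : 0 < u ^ 2)%N) ?expn_gt0 ?u0 // ltn_ceil.
pose cF := cliques F r.
pose A := ~: (R1 :|: R2); pose k0 := (#|A| %/ r)%N; pose g := (#|cF| - 3 * u)%N.
have cA : #|A| = (n - 8 * u)%N.
  rewrite /A cardsCs setCK cardsU disjoint_setI0 // cards0 subn0 cR1 cR2 -/n.
  by rewrite -mulnDl.
have A2 : (n <= 2 * #|A|)%N by rewrite cA; move: un; rewrite -/n; clear; lia.
have k0A : (k0 * r <= #|A|)%N by apply: leq_trunc_div.
have cFn : (#|cF| * r <= n)%N.
  rewrite -card_cover_uniform ?max_card ?trivIset_cliques // => C.
  by rewrite inE => /andP[/eqP].
have k0r : (n - 8 * u < (k0 + 1) * r)%N by rewrite -cA addn1 ltn_ceil.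
have rn : (4 * r <= n)%N by rewrite (leq_trans _ nn0) // leq_addl.
have Dn : Delta%:R * n%:R * mu1 = n%:R / (12 * D * r)%:R.
  rewrite /mu1 natrM invfM; set z := _%:R^-1.
  by field; rewrite gt_eqF.
have Dr0 : 0 < (12 * D * r)%:R :> R by rewrite ltr0n !muln_gt0 D0.
pose k := (n %/ (12 * D * r))%N.
have kL : k%:R <= Delta%:R * #|T|%:R * mu1.
  by rewrite Dn ler_pdivlMr // -natrM ler_nat leq_trunc_div.
have gk0 : g%:R + Delta%:R * #|T|%:R * mu1 <= k0%:R.
  rewrite Dn -lerBrDl ler_pdivrMr //.
  case: (tiling_count_bound r3 u6 un cFn k0r rn); rewrite -/g -(ler_nat R) natrD.
    rewrite !natrM => le; have : (4 * r%:R * g%:R + n%:R) * D%:R * 3 <= 4 * r%:R * k0%:R * D%:R * 3 :> R.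
      by rewrite ler_pM2r // ler_pM2r ?ltr0n.
    have : n%:R <= n%:R * D%:R :> R by rewrite -natrM ler_nat leq_pmulr.
    have : 0 <= n%:R :> R by [].
    clear; lra.
  rewrite !natrM => le.
  have : (6 * g%:R + u%:R) * D%:R * r%:R * 2 <= 6 * k0%:R * D%:R * r%:R * 2 :> R.
    by rewrite ler_pM2r // ler_pM2r ?ltr0n // ler_pM2r ?ltr0n.
  have : n%:R <= 2 * D%:R * u%:R * r%:R :> R.
    by rewrite -!natrM ler_nat (leq_trans nu) // leq_pmulr.
  clear; lra.
pose s := (2 * (r ^ 2 - 1))%N.
have ys0 : 0 < y ^+ s by rewrite exprn_gt0.
have p1E : (K1 * y) ^+ s / mu1 ^+ 2 = c0 * y ^+ s by rewrite exprMn mulrAC.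
have cy : c0 * y ^+ s + M.+1%:R * y ^+ s <= p by rewrite -mulrDl.
have My0 : 0 <= M.+1%:R * y ^+ s by rewrite mulr_ge0 // ltW.
have p1_le1 : c0 * y ^+ s <= 1 by move: cy My0 p1; clear; lra.
have p1_ge0 : 0 <= c0 * y ^+ s by rewrite mulr_ge0 // ltW.
have phase1 : 1 - 48 * (D * r)%:R * y <= Ex (pairs T) (c0 * y ^+ s) (fun W => (has_cliques A r g W)%:R).
  have mu08 : 0 < mu1 <= 1 / 8 by rewrite mu10.
  have := @Ex_near_tiling R T A Delta k0 y mu1 Delta1 k0A A2 n_gt0 y0 ny K1y mu08 _ g k kL gk0.
  rewrite -/s p1E => /(_ p1_le1); apply: le_trans.
  rewrite lerD2l lerN2.
  (* The failure is exponentially small in [k], of order [n]; a bound of order [1 / n], that is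
     [y ^+ M], is all that is kept. *)
  apply: le_trans (_ : 4 * (1 / 2) ^+ k.+1 <= _).
    have mu2 : 4 * mu1 <= 1 / 2 by move: mu18; clear; lra.
    by rewrite ler_pM2l // lerXn2r // ?nnegrE ?divr_ge0 // mulr_ge0 // ltW.
  apply: le_trans (_ : 4 * (12 * D * r)%:R * y ^+ M <= _); last first.
    rewrite (_ : 48 * (D * r)%:R * y = 4 * (12 * D * r)%:R * y :> R); last by rewrite !natrM; ring.
    by rewrite ler_wpM2l // mulr_ge0.
  rewrite -mulrA ler_pM2l //; apply: le_trans (half_exp_le _ _) _.
  apply: le_trans (_ : k.+1%:R^-1 <= _).
    by rewrite lef_pV2 ?posrE ?ltr0n // ler_nat.
  rewrite -div1r ler_pdivrMr ?ltr0n // -[leLHS]ny [leRHS]mulrAC ler_pM2r ?exprn_gt0 //.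
  by rewrite -natrM ler_nat mulnC ltnW // ltn_ceil // !muln_gt0 D0.
have y01 : 0 <= y ^+ s <= 1 by rewrite exprn_ge0 ?exprn_ile1 // ltW.
have /andP[r0 r1] := rounds01 M.+1 y01.
have rle := rounds_le M.+1 y01.
pose q := rounds (y ^+ s) M.+1.
(* The two phases together expose a set of density at most [p], and containing an image of [F] is a
   monotone event. *)
apply: le_trans (_ : Ex (pairs T) (c0 * y ^+ s + q - c0 * y ^+ s * q)
  (fun W => [exists f : {perm T}, img_edges f F \subset E :|: W]%:R) <= _); last first.
  apply: Ex_mono => //.
  - have : 0 <= (1 - c0 * y ^+ s) * q by apply: mulr_ge0; [rewrite subr_ge0 | exact: r0].
    by move: p1_ge0; clear; lra.
  - have : 0 <= c0 * y ^+ s * q by apply: mulr_ge0; [|exact: r0].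
    by move: rle cy; rewrite -/q; clear; lra.
  - move=> W W' WW'; rewrite ler_nat; case: (boolP [exists f, _]) => // /existsP[f fW].
    suff -> : [exists f : {perm T}, img_edges f F \subset E :|: W'] by [].
    by apply/existsP; exists f; apply: subset_trans fW (setUS _ WW').
rewrite -Ex_union.
pose delta := 16 * (K2 ^+ (r ^ 2) * y) * 2 ^+ M.+1.
apply: le_trans (_ : Ex (pairs T) (c0 * y ^+ s) (fun W => (has_cliques A r g W)%:R - delta) <= _).
  rewrite ExD Ex_cst; apply: le_trans (lerB phase1 (lexx delta)).
  by rewrite /delta le_eqVlt; apply/orP; left; apply/eqP; ring.
apply: le_Ex => [|W1 _]; first by rewrite p1_ge0.
have delta0 : 0 <= delta by rewrite !mulr_ge0 ?exprn_ge0 // ltW.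
case: (boolP (has_cliques A r g W1)) => [cl|_]; last first.
  apply: le_trans (_ : 0 <= _); first by rewrite sub0r oppr_le0.
  rewrite -[leLHS](Ex_cst (pairs T) q); apply: le_Ex => [|W _]; first by rewrite r0.
  by [].
have small : Delta%:R * n%:R * (K2 ^+ (r ^ 2) * y) ^+ M.+1 < 1.
  rewrite exprMn -exprM (_ : _ * _ = Delta%:R * K2 ^+ (r ^ 2 * M.+1) * y * (n%:R * y ^+ M)).
    by rewrite ny mulr1; move: Ly; clear; lra.
  by rewrite exprSr; ring.
have := @Ex_second_phase R T F E W1 Delta u c B R1 R2 y F2 Delta1 deg u0 (ltn0Sn _) un R12 cR1 cR2
  cdense Bu Bc cl y0 y1 ny K2y mu2y small.
move/le_trans; apply; apply: le_Ex => [|W2 _]; first by rewrite r0.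
by rewrite setUA.
Qed.

(** Bernoulli's inequality for [31 / 30]. It shows that any [K] above [60 / eps] allows enough
    density increments. *)
Lemma geometric_bound (R : realFieldType) (k : nat) :
  (30 / 31) ^+ k * (1 + k%:R / 30) <= 1 :> R.
Proof.
elim: k => [|k IH]; first by rewrite expr0; lra.
apply: le_trans IH; rewrite exprSr -(natr1 k) -mulrA.
have k0 : 0 <= k%:R :> R by [].
by rewrite ler_wpM2l ?exprn_ge0 ?divr_ge0 //; lra.
Qed.

(** * Transfer to the binomial random graph and passage to the limit *)

Lemma Ex_gnp (R : realFieldType) (V : finType) (p : R) (f : {set {set V}} -> R) :
  Ex (pairs V) p f = \sum_(H : sgraph V) gnp_pmf p H * f (edges H).
Proof.
rewrite /Ex (reindex_omap (fun H : sgraph V => edges H) insub) /=; last first.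
  by move=> W WP; rewrite insubT.
apply: eq_big => [H|H _]; first by rewrite edges_pairs valK eqxx.
congr (_ * _); rewrite /gnp_pmf (bigID (fun e => e \in edges H)) /=; congr (_ * _).
  rewrite -prodr_const; apply: eq_big => [e|e eH].
    by apply/idP/andP => [eH|[]//]; rewrite (subsetP (edges_pairs H)).
  by rewrite eH.
rewrite -prodr_const; apply: eq_big => [e|e]; first by rewrite !inE andbC.
by rewrite !inE => /andP[/negbTE -> _].
Qed.

Lemma gnp_pr_le1 (R : realFieldType) (V : finType) (p : R) (A : pred (sgraph V)) :
  0 <= p <= 1 -> gnp_pr p A <= 1.
Proof.
move=> p01; rewrite -(Ex_cst (pairs V) p 1) Ex_gnp /gnp_pr big_mkcond.
apply: ler_sum => H _; rewrite mulr1; case: ifP => // _.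
rewrite /gnp_pmf prodr_ge0 // => e _; case/andP: p01 => p0 p1.
by case: ifP => _; rewrite ?subr_ge0.
Qed.

Lemma Ex_le_gnp_pr_contains (R : realFieldType) (V : finType) (p : R) (F G : sgraph V) :
  0 <= p <= 1 ->
  Ex (pairs V) p (fun W => [exists f : {perm V},
      img_edges f (edges F) \subset edges G :|: W]%:R)
    <= gnp_pr p [pred H : sgraph V | contains_copy F (gunion G H)].
Proof.
move=> /andP[p0 p1]; rewrite Ex_gnp /gnp_pr [leRHS]big_mkcond; apply: ler_sum => H _ /=.
have pmf0 : 0 <= gnp_pmf p H.
  by rewrite /gnp_pmf prodr_ge0 // => e _; case: ifP => _; rewrite ?subr_ge0.
case: (boolP [exists f, _]) => [/existsP[f /subsetP fH]|_]; last first.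
  by rewrite mulr0; case: ifP.
suff -> : contains_copy F (gunion G H) by rewrite mulr1.
apply/existsP; exists [ffun v => f v]; apply/andP; split.
  by apply/injectiveP => u v; rewrite !ffunE => /perm_inj.
apply/forall_inP => e eF; rewrite /= (eq_imset _ (ffunE _)).
by apply: fH; apply/imsetP; exists e.
Qed.

From mathcomp Require Import all_classical all_reals all_analysis.
Import numFieldNormedType.Exports.
Local Open Scope classical_set_scope.
Unset Implicit Arguments.

Theorem theorem1p6 (R : realType) (eps : R) (Delta : nat) (heps : 0 < eps)
    (hDelta : (2 <= Delta)%N) :
  exists c : R,
    forall (F G : forall n : nat, sgraph 'I_n) (p : nat -> R),
      (\forall n \near \oo,
         [/\ (max_degree (F n) <= Delta)%N,
             0 <= p n <= 1,
             c * (n%:R `^ (- (2 / (Delta.+1)%:R))) <= p n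
           & eps * n%:R ^+ 2 <= (#|edges (G n)|)%:R]) ->
      (fun n : nat =>
         gnp_pr (p n) [pred H : sgraph 'I_n | contains_copy (F n) (gunion (G n) H)])
        @ \oo --> (1 : R).
Proof.
pose K := Num.bound (60 / eps).
have K0 : 60 / eps < K%:R by apply: archi_boundP; rewrite divr_ge0 // ltW.
have Keps : (30 / 31) ^+ K <= eps / 2.
  have h0 : 0 < 1 + K%:R / 30 :> R by rewrite ltr_pwDl // divr_ge0.
  rewrite -(ler_pM2r h0); apply: le_trans (geometric_bound R K) _.
  have : 60 < K%:R * eps by rewrite -ltr_pdivrMr.
  by move: heps; clear; lra.
pose D0 := Num.bound ((4 ^ K.+1)%:R / (eps / 2)).
have e20 : 0 < eps / 2 by rewrite divr_gt0.
have D0P : (4 ^ K.+1)%:R <= eps / 2 * D0%:R.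
  rewrite mulrC -ler_pdivrMr // ltW //; apply: archi_boundP.
  by rewrite divr_ge0 // ltW.
pose D := (4 ^ K.+2 + D0)%N.
have KD : (4 ^ K.+2 <= D)%N by rewrite leq_addr.
have KepsD : (4 ^ K.+1)%:R <= eps / 2 * D%:R.
  by apply: le_trans D0P _; rewrite ler_pM2l // ler_nat leq_addl.
have [c [Cerr [y0 [y00 Cerr0 main]]]] := perturbed_contains hDelta Keps KD KepsD.
exists c => F G p hyp.
pose r := Delta.+1; pose M := (r * (r ^ 2 - 1))%N.
have M0 : (0 < M)%N by rewrite muln_gt0 /= subn_gt0 sqr_gt1 // ltnW.
pose y n : R := n%:R `^ (- M%:R^-1).
have ypow n k : (y n) ^+ k = n%:R `^ (- (k%:R / M%:R)).
  by rewrite -powR_mulrn ?powR_ge0 // -powRrM mulNr mulrC.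
have yM n : (0 < n)%N -> n%:R * y n ^+ M = 1.
  move=> n0; rewrite ypow divff ?pnatr_eq0 -?lt0n // powR_inv1 ?ler0n // divff //.
  by rewrite pnatr_eq0 -lt0n.
have ysmall (e : R) : 0 < e -> \forall n \near \oo, (0 < n)%N /\ y n <= e.
  move=> e0; near=> n.
  have n0 : (0 < n)%N by near: n; exists 1%N.
  split=> //; rewrite leNgt; apply/negP => lt.
  have : (e ^+ M)^-1 <= n%:R by near: n; apply: nbhs_infty_ger.
  rewrite -[leLHS]mul1r ler_pdivrMr ?exprn_gt0 // -[leLHS](yM n n0) ler_pM2l ?ltr0n //.
  by rewrite leNgt => /negP; apply; rewrite (ltr_pXn2r M0) ?nnegrE ?powR_ge0 ?(ltW e0).
apply/cvgrPdist_le => e e0.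
(* [y0] is the range of the uniform bound, the other term makes the error at most [e]; adding 1
   avoids a division by zero. *)
have e1 : 0 < Num.min y0 (e / (Cerr + 1)).
  by rewrite lt_min y00 divr_gt0 // ltr_wpDl.
near=> n.
have [n0 ] : (0 < n)%N /\ y n <= Num.min y0 (e / (Cerr + 1)) by near: n; apply: ysmall.
rewrite le_min => /andP[yy0 ye].
have [Fdeg p01 cp Geps] : [/\ (max_degree (F n) <= Delta)%N, 0 <= p n <= 1,
    c * (n%:R `^ (- (2 / (Delta.+1)%:R))) <= p n
  & eps * n%:R ^+ 2 <= (#|edges (G n)|)%:R] by near: n.
have yn0 : 0 < y n by rewrite powR_gt0 // ltr0n.
have deg v : (#|[set e in edges (F n) | v \in e]| <= Delta)%N.
  exact: leq_trans (leq_bigmax v) Fdeg.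
have := main 'I_n (edges (F n)) (edges (G n)) (p n) (y n) (edges_pairs _) (edges_pairs _) deg.
rewrite card_ord yn0 yy0 => /(_ Geps isT (yM n n0)).
have -> : y n ^+ (2 * (r ^ 2 - 1)) = n%:R `^ (- (2 / r%:R)).
  rewrite ypow /M; congr (_ `^ (- _)).
  rewrite !natrM; field.
  rewrite !pnatr_eq0 /= -lt0n.
  by move: M0; rewrite muln_gt0 => /andP[].
rewrite cp; case/andP: (p01) => _ -> /(_ isT) le1.
have le2 := le_trans le1 (Ex_le_gnp_pr_contains (F n) (G n) p01).
rewrite ger0_norm ?subr_ge0 ?gnp_pr_le1 //.
have : Cerr * y n <= e.
  apply: le_trans (_ : (Cerr + 1) * y n <= _).
    by rewrite ler_pM2r // lerDl.
  by rewrite mulrC -ler_pdivlMr // ltr_wpDl.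
move: le2; clear; move: (Cerr * _) (gnp_pr _ _) => a b; lra.
Unshelve. all: by end_near.
Qed.
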